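(* Let $(A,\rho,[\cdot,\cdot])$ be a Lie algebroid with underlying vector bundle of odd rank $2m+1$. Let $(\Omega,\eta)$ be an almost cosymplectic structure on $A$ and let $(\Pi,\xi)$ be the associated fundamental pair. Then $(\Omega,\eta)$ is a contact structure (i.e. $\Omega=d_\rho\eta$) if and only if $(\Pi,\xi)$ is a Jacobi structure.
   Context: A Lie algebroid on a smooth manifold $M$ is a vector bundle $A\to M$ with a vector bundle morphism $\rho:A\to TM$ (the anchor) and a skew-symmetric $\mathbb{R}$-bilinear bracket on $\Gamma(A)$ satisfying $[a,\varphi b]=\varphi[a,b]+(\rho(a)\cdot\varphi)b$ and the Jacobi identity. Exterior differential: $d_\rho\varphi(a)=\rho(a)\cdot\varphi$ and, for $\eta\in\Gamma(\wedge^kA^\star)$, $d_\rho\eta(a_0,\dots,a_k)=\sum_i(-1)^i\rho(a_i)\cdot\eta(a_0,\dots,\widehat{a_i},\dots,a_k)+\sum_{i<j}(-1)^{i+j}\eta([a_i,a_j],a_0,\dots,\widehat{a_i},\dots,\widehat{a_j},\dots,a_k)$. Lie derivative: $\mathcal{L}^\rho_a\varphi=\rho(a)\cdot\varphi$, $(\mathcal{L}^\rho_a\eta)(a_1,\dots,a_k)=\rho(a)\cdot\eta(a_1,\dots,a_k)-\sum_i\eta(a_1,\dots,[a,a_i],\dots,a_k)$, and $\langle\mathcal{L}^\rho_aP,\eta\rangle=\rho(a)\cdot\langle P,\eta\rangle-\langle P,\mathcal{L}^\rho_a\eta\rangle$ for multivector fields $P$. Interior product: $i_a\Omega=\Omega(a,\cdot)$.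 The Schouten–Nijenhuis bracket on $\Gamma(\wedge^\bullet A)$ is the unique $\mathbb{R}$-bilinear bracket with $[\varphi,\psi]=0$ for functions, $[a,P]=\mathcal{L}^\rho_aP$ for $a\in\Gamma(A)$, $[P,Q]=(-1)^{kl}[Q,P]$ and $[P,Q\wedge R]=[P,Q]\wedge R+(-1)^{(k+1)l}Q\wedge[P,R]$ for $P\in\Gamma(\wedge^kA)$, $Q\in\Gamma(\wedge^lA)$. Exterior products are normalised so that $(\xi\wedge\Pi)(\alpha,\beta,\gamma)=\alpha(\xi)\Pi(\beta,\gamma)+\beta(\xi)\Pi(\gamma,\alpha)+\gamma(\xi)\Pi(\alpha,\beta)$, and similarly for forms. A pair $(\Pi,\xi)$ with $\Pi\in\Gamma(\wedge^2A)$, $\xi\in\Gamma(A)$ is a Jacobi structure if $[\Pi,\Pi]=2\xi\wedge\Pi$ and $\mathcal{L}^\rho_\xi\Pi=0$. An almost cosymplectic structure on $A$ (of rank $2m+1$) is a pair $(\Omega,\eta)$ of a $2$-form $\Omega\in\Gamma(\wedge^2A^\star)$ and a $1$-form $\eta\in\Gamma(A^\star)$ such that $\eta\wedge\Omega^m$ is nowhere zero. Its Reeb section is the unique $\xi\in\Gamma(A)$ with $i_\xi\Omega=0$ and $\eta(\xi)=1$. The map $\flat_{\Omega,\eta}:A\to A^\star$, $\flat_{\Omega,\eta}(a)=-i_a\Omega+\eta(a)\eta$, is an isomorphism with inverse $\sharp_{\Omega,\eta}$; put $\Pi(\alpha,\beta)=\Omega(\sharp_{\Omega,\eta}(\alpha),\sharp_{\Omega,\eta}(\beta))$.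 The pair $(\Pi,\xi)$ is the associated fundamental pair. A contact structure on $A$ is a $1$-form $\eta$ with $\eta\wedge(d_\rho\eta)^m$ nowhere zero, i.e. an almost cosymplectic structure $(\Omega,\eta)$ with $\Omega=d_\rho\eta$. *)

(* Defs.v *)
From mathcomp Require Import all_boot all_order all_algebra.
From mathcomp Require Import all_classical all_reals all_analysis.

Set Implicit Arguments.
Unset Strict Implicit.
Unset Printing Implicit Defensive.

Import Order.TTheory GRing.Theory Num.Theory.
Import numFieldNormedType.Exports.

Local Open Scope classical_set_scope.
Local Open Scope ring_scope.

(* C^oo: all iterated directional derivatives are Frechet differentiable at
   every point of U (U is always an open set below). *)
Definition smooth_on (R : realType) (n : nat)
    (U : set 'rV[R]_n) (f : 'rV[R]_n -> R) : Prop :=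
  forall (vs : seq 'rV[R]_n) (p : 'rV[R]_n), U p ->
    differentiable (foldr (fun v g => 'D_v g) f vs : 'rV[R]_n -> R^o) p.

(* The smooth structure is given by an atlas, not necessarily maximal. *)
Record manifold (R : realType) (n : nat) := Manifold {
  msort :> topologicalType;
  m_hausdorff : hausdorff_space msort;
  m_second_countable : @second_countable msort;
  chart : Type;
  cdom : chart -> set msort;
  cmap : chart -> msort -> 'rV[R]_n;
  cinv : chart -> 'rV[R]_n -> msort;
  cdom_open : forall c, open (cdom c);
  cdom_cover : forall x, exists c, cdom c x;
  cimg_open : forall c, open (cmap c @` cdom c);
  cmapK : forall c x, cdom c x -> cinv c (cmap c x) = x;
  cmap_continuous : forall c x, cdom c x -> {for x, continuous (cmap c)};
  cinv_continuous :
    forall c p, (cmap c @` cdom c) p -> {for p, continuous (cinv c)};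
  chart_compat : forall c d (k : 'I_n),
    smooth_on (cmap c @` (cdom c `&` cdom d))
              (fun p => cmap d (cinv c p) ord0 k) }.

Definition smooth_fun_on (R : realType) (n : nat) (M : manifold R n)
    (U : set M) (f : M -> R) : Prop :=
  forall c : chart M,
    smooth_on (cmap c @` (cdom c `&` U)) (fun p => f (cinv c p)).

Definition smooth_fun (R : realType) (n : nat) (M : manifold R n)
    (f : M -> R) : Prop := smooth_fun_on setT f.

(* T_x M as the derivations at x of C^oo(M); values at non-smooth functions
   are irrelevant. *)
Record tangent (R : realType) (n : nat) (M : manifold R n) (x : M) := Tangent {
  tderiv :> (M -> R) -> R;
  tderiv_linear : forall (c : R) (f g : M -> R), smooth_fun f -> smooth_fun g ->
    tderiv (fun y => c * f y + g y) = c * tderiv f + tderiv g;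
  tderiv_leibniz : forall f g : M -> R, smooth_fun f -> smooth_fun g ->
    tderiv (fun y => f y * g y) = f x * tderiv g + g x * tderiv f }.

(* A family of vector spaces with local trivialisations whose transition maps
   are smooth; the total space carries the manifold structure these induce. *)
Record vbundle (R : realType) (n : nat) (M : manifold R n) (r : nat) := VBundle {
  fibre :> M -> vectType R;
  triv_idx : Type;
  tdom : triv_idx -> set M;
  triv : forall (j : triv_idx) (x : M), 'Hom(fibre x, 'rV[R]_r);
  tdom_open : forall j, open (tdom j);
  tdom_cover : forall x, exists j, tdom j x;
  triv_bij : forall j x, tdom j x -> bijective (triv j x);
  triv_compat : forall j k (v : 'rV[R]_r) (i : 'I_r),
    smooth_fun_on (tdom j `&` tdom k)
      (fun x => triv k x ((triv j x)^-1%VF v) ord0 i) }.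

Definition dual (R : realType) (V : vectType R) : vectType R := 'Hom(V, R^o).

Section Tensors.
Context (R : realType) (n : nat) (M : manifold R n) (r : nat)
        (A : vbundle M r).

Definition frame (j : triv_idx A) (x : M) (i : 'I_r) : A x :=
  (triv j x)^-1%VF (delta_mx ord0 i).

Definition coframe (j : triv_idx A) (x : M) (i : 'I_r) : dual (A x) :=
  linfun (fun v => triv j x v ord0 i : R^o).

(* Not necessarily smooth; Gamma(A) is cut out by [smooth_section]. *)
Definition section := forall x : M, A x.

Definition smooth_section (a : section) : Prop :=
  forall (j : triv_idx A) (i : 'I_r),
    smooth_fun_on (tdom j) (fun x => triv j x (a x) ord0 i).

Definition cosection := forall x : M, dual (A x).

Definition smooth_cosection (al : cosection) : Prop :=
  forall (j : triv_idx A) (i : 'I_r),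
    smooth_fun_on (tdom j) (fun x => al x (frame j x i)).

(* An element w of the exterior algebra of V* is encoded by its values on all
   finite sequences of vectors: its component of degree k is the restriction
   of w to sequences of size k, an alternating k-linear map. *)
Definition alternating (V : vectType R) (w : seq V -> R) : Prop :=
  (forall (s t : seq V) (c : R) (u v : V),
     w (s ++ (c *: u + v) :: t) = c * w (s ++ u :: t) + w (s ++ v :: t)) /\
  (forall s : seq V, ~~ uniq s -> w s = 0).

Definition homogeneous (T : Type) (k : nat) (w : seq T -> R) : Prop :=
  forall s : seq T, size s != k -> w s = 0.

(* Sections of the exterior algebras of A^* and of A; a k-vector is an
   alternating k-linear function of covectors. *)
Definition diff_form := forall x : M, seq (A x) -> R.
Definition multivector := forall x : M, seq (dual (A x)) -> R.

Definition smooth_form (w : diff_form) : Prop :=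
  (forall x, alternating (w x)) /\
  (forall (j : triv_idx A) (s : seq 'I_r),
     smooth_fun_on (tdom j) (fun x => w x (map (frame j x) s))).

Definition smooth_multivector (P : multivector) : Prop :=
  (forall x, alternating (P x)) /\
  (forall (j : triv_idx A) (s : seq 'I_r),
     smooth_fun_on (tdom j) (fun x => P x (map (coframe j x) s))).

Definition kform (k : nat) (w : diff_form) : Prop :=
  smooth_form w /\ forall x, homogeneous k (w x).

Definition kvector (k : nat) (P : multivector) : Prop :=
  smooth_multivector P /\ forall x, homogeneous k (P x).

Definition form_of_cosection (al : cosection) : diff_form :=
  fun x s => if s is [:: v] then al x v else 0.

Definition multivector_of_fun (f : M -> R) : multivector :=
  fun x s => if s is [::] then f x else 0.

Definition multivector_of_section (a : section) : multivector :=
  fun x s => if s is [:: al] then al (a x) else 0.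

Arguments form_of_cosection al x s : clear implicits.
Arguments multivector_of_fun f x s : clear implicits.
Arguments multivector_of_section a x s : clear implicits.

(* The first factor receives the arguments selected by the mask m, the second
   one the others; the sign is that of the corresponding shuffle.  Thus
   (al /\ be)(u, v) = al(u) be(v) - al(v) be(u). *)
Definition shuffle_inv (k : nat) (m : k.-tuple bool) : nat :=
  (\sum_(i < k) \sum_(j < k | (i < j)%N) (~~ tnth m i && tnth m j))%N.

Definition wedge (T : Type) (w1 w2 : seq T -> R) : seq T -> R :=
  fun s => \sum_(m : (size s).-tuple bool)
    (-1) ^+ shuffle_inv m * w1 (mask m s) * w2 (mask (map negb m) s).

Definition wedge_exp (T : Type) (w : seq T -> R) (k : nat) : seq T -> R :=
  iter k (wedge w) (fun s => (nilp s)%:R).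

(* Pairing of the exterior algebras of V and V*, with
   <a1 /\ ... /\ ak, al1 /\ ... /\ alk> = det (al_j (a_i)); it does not depend
   on the basis used. *)
Definition pairing (V : vectType R) (P : seq (dual V) -> R) (w : seq V -> R)
    : R :=
  let e := vbasis (fullv : {vspace V}) in
  let e' (i : 'I_(\dim (fullv : {vspace V}))) : dual V :=
    linfun (fun v => coord e i v : R^o) in
  \sum_(I : {set 'I_(\dim (fullv : {vspace V}))})
    P [seq e' i | i <- enum I] * w [seq e`_i | i : 'I__ <- enum I].

Definition almost_cosymplectic (m : nat) (Om : diff_form) (eta : cosection) : Prop :=
  [/\ kform 2 Om, smooth_cosection eta &
      forall x, exists s : seq (A x),
        wedge (form_of_cosection eta x) (wedge_exp (Om x) m) s != 0].

Definition reeb_section (Om : diff_form) (eta : cosection) (xi : section) : Prop :=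
  [/\ smooth_section xi,
      forall x (v : A x), Om x [:: xi x; v] = 0 &
      forall x, eta x (xi x) = 1].

Definition flat (Om : diff_form) (eta : cosection) (x : M) : 'Hom(A x, dual (A x)) :=
  linfun (fun a : A x =>
    linfun (fun b : A x => - Om x [:: a; b] + eta x a * eta x b : R^o)
      : dual (A x)).

Definition sharp (Om : diff_form) (eta : cosection) (x : M) : 'Hom(dual (A x), A x) :=
  (flat Om eta x)^-1%VF.

Definition fundamental_bivector (Om : diff_form) (eta : cosection) : multivector :=
  fun x s => if s is [:: al; be]
             then Om x [:: sharp Om eta x al; sharp Om eta x be] else 0.

Definition fundamental_pair (Om : diff_form) (eta : cosection)
    (Pi : multivector) (xi : section) : Prop :=
  Pi = fundamental_bivector Om eta /\ reeb_section Om eta xi.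

Definition eval_form (w : diff_form) (s : seq section) : M -> R :=
  fun x => w x [seq a x | a <- s].

(* Such a section always exists (bump functions); the default is never used. *)
Definition extend (x : M) (v : A x) : section :=
  if pselect (exists a : section, smooth_section a /\ a x = v) is left h
  then projT1 (cid h) else fun=> 0.

(* The form defined by a C^oo(M)-multilinear map F on sections: the value of
   F s at x then only depends on the values at x of the sections in s. *)
Definition tensor_at (F : seq section -> M -> R) : diff_form :=
  fun x s => F [seq extend v | v <- s] x.

End Tensors.

Arguments section {R n M r} A.
Arguments cosection {R n M r} A.
Arguments diff_form {R n M r} A.
Arguments multivector {R n M r} A.
Arguments form_of_cosection {R n M r A} al x s.
Arguments multivector_of_fun {R n M r} A f x s.
Arguments multivector_of_section {R n M r A} a x s.
Arguments fundamental_bivector {R n M r A} Om eta x s.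
Arguments tensor_at {R n M r A} F x s.

Record lie_algebroid (R : realType) (n : nat) (M : manifold R n) (r : nat)
    (A : vbundle M r) := LieAlgebroid {
  anchor : forall x : M, A x -> tangent x;
  anchor_linear : forall x (c : R) (u v : A x) (f : M -> R), smooth_fun f ->
    anchor (c *: u + v) f = c * anchor u f + anchor v f;
  anchor_smooth : forall (a : section A) (f : M -> R),
    smooth_section a -> smooth_fun f -> smooth_fun (fun x => anchor (a x) f);
  bracket : section A -> section A -> section A;
  bracket_smooth : forall a b, smooth_section a -> smooth_section b ->
    smooth_section (bracket a b);
  bracket_skew : forall a b, smooth_section a -> smooth_section b ->
    forall x, bracket a b x = - bracket b a x;
  bracket_linear : forall (c : R) a a' b,
    smooth_section a -> smooth_section a' -> smooth_section b ->
    forall x, bracket (fun y => c *: a y + a' y) b x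
              = c *: bracket a b x + bracket a' b x;
  bracket_leibniz : forall (f : M -> R) a b,
    smooth_fun f -> smooth_section a -> smooth_section b ->
    forall x, bracket a (fun y => f y *: b y) x
              = f x *: bracket a b x + anchor (a x) f *: b x;
  bracket_jacobi : forall a b c,
    smooth_section a -> smooth_section b -> smooth_section c ->
    forall x, bracket a (bracket b c) x + bracket b (bracket c a) x
              + bracket c (bracket a b) x = 0 }.

Section Calculus.
Context (R : realType) (n : nat) (M : manifold R n) (r : nat)
        (A : vbundle M r) (L : lie_algebroid A).

Definition act (a : section A) (f : M -> R) : M -> R :=
  fun x => anchor L (a x) f.

Definition omit (T : Type) (i : nat) (s : seq T) : seq T :=
  take i s ++ drop i.+1 s.

Definition ext_diff (w : diff_form A) : diff_form A :=
  tensor_at (fun (s : seq (section A)) (x : M) =>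
    let a i := nth (fun=> 0) s i in
    \sum_(i < size s) (-1) ^+ i * act (a i) (eval_form w (omit i s)) x
    + \sum_(i < size s) \sum_(j < size s | (i < j)%N)
        (-1) ^+ (i + j)
        * eval_form w (bracket L (a i) (a j) :: omit i (omit j s)) x).

Definition lie_form (a : section A) (w : diff_form A) : diff_form A :=
  tensor_at (fun (s : seq (section A)) (x : M) =>
    act a (eval_form w s) x
    - \sum_(i < size s)
        eval_form w (set_nth (fun=> 0) s i
                       (bracket L a (nth (fun=> 0) s i))) x).

Arguments ext_diff w x s : clear implicits.
Arguments lie_form a w x s : clear implicits.

(* Q is the Lie derivative of P along a; it is unique since the pairing is
   nondegenerate on each fibre. *)
Definition is_lie_multivector (a : section A) (P Q : multivector A) : Prop :=
  smooth_multivector Q /\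
  forall w : diff_form A, smooth_form w -> forall x,
    pairing (Q x) (w x)
    = act a (fun y => pairing (P y) (w y)) x
      - pairing (P x) (lie_form a w x).

(* Only the values of B on Gamma(wedge A) matter; B is determined there. *)
Record is_schouten (B : multivector A -> multivector A -> multivector A)
    : Prop := IsSchouten {
  schouten_smooth : forall P Q,
    smooth_multivector P -> smooth_multivector Q -> smooth_multivector (B P Q);
  schouten_linearl : forall (c : R) P P' Q,
    smooth_multivector P -> smooth_multivector P' -> smooth_multivector Q ->
    B (fun x s => c * P x s + P' x s) Q
    = (fun x s => c * B P Q x s + B P' Q x s);
  schouten_linearr : forall (c : R) P Q Q',
    smooth_multivector P -> smooth_multivector Q -> smooth_multivector Q' ->
    B P (fun x s => c * Q x s + Q' x s)
    = (fun x s => c * B P Q x s + B P Q' x s);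
  schouten_fun : forall f g : M -> R, smooth_fun f -> smooth_fun g ->
    B (multivector_of_fun A f) (multivector_of_fun A g) = (fun _ _ => 0);
  schouten_section : forall (a : section A) P,
    smooth_section a -> smooth_multivector P ->
    is_lie_multivector a P (B (multivector_of_section a) P);
  schouten_sym : forall k l P Q, kvector k P -> kvector l Q ->
    B P Q = (fun x s => (-1) ^+ (k * l) * B Q P x s);
  schouten_leibniz : forall k l P Q S,
    kvector k P -> kvector l Q -> smooth_multivector S ->
    B P (fun x => wedge (Q x) (S x))
    = (fun x s => wedge (B P Q x) (S x) s
                  + (-1) ^+ ((k + 1) * l) * wedge (Q x) (B P S x) s) }.

Definition jacobi_structure
    (B : multivector A -> multivector A -> multivector A)
    (Pi : multivector A) (xi : section A) : Prop :=
  [/\ kvector 2 Pi, smooth_section xi,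
      B Pi Pi
      = (fun x s => 2 * wedge (multivector_of_section xi x) (Pi x) s) &
      is_lie_multivector xi Pi (fun _ _ => 0)].

Definition contact_structure (m : nat) (Om : diff_form A) (eta : cosection A)
    : Prop :=
  almost_cosymplectic m Om eta /\ Om = ext_diff (form_of_cosection eta).

End Calculus.

Arguments ext_diff {R n M r A} L w x s.
Arguments lie_form {R n M r A} L a w x s.

(* Main.v *)
From HB Require Import structures.
Require Import Defs.
From mathcomp Require Import all_boot all_order all_algebra.
From mathcomp Require Import all_classical all_reals all_analysis.
From mathcomp Require Import ring lra zify.

Set Implicit Arguments.
Unset Strict Implicit.
Unset Printing Implicit Defensive.

Import Order.TTheory GRing.Theory Num.Theory.
Import numFieldNormedType.Exports.

Local Open Scope classical_set_scope.
Local Open Scope ring_scope.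

Local Notation alternating := Defs.alternating.

(** Let [sharp al] be the vector with [be (sharp al) = Pi (al, be)] for every
    covector [be]. The theorem is read off from two formulas, valid for any
    bivector field [Pi], any section [c] and any covector fields [al], [be],
    [ga] with sharps [u], [v], [w]:

      [c, Pi](al, be)      = be [c, u] - al [c, v] - c . Pi(al, be),
      [Pi, Pi](al, be, ga) = - 2 * (cyclic sum of al [v, w] - u . Pi(be, ga)),

    which are [schouten_section_bivector] and [schouten_bivector].

    When [Pi] comes from [(Om, eta)], every covector is [- i_a Om + k eta] with
    [a] horizontal, that is [eta a = 0], and then its sharp is [a] itself. The
    two formulas become relations between horizontal sections ([schouten_reeb]
    and [schouten_fundamental]). Testing [Pi, Pi] = 2 xi /\ Pi on the covectors
    [eta], [- i_b Om], [- i_c Om] gives [Om (b, c) = - eta [b, c]], which is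
    [d eta (b, c)]; testing the invariance of [Pi] under [xi] on [- i_a Om] and
    [eta] gives [eta [a, xi] = 0], which is [d eta (xi, a) = 0]. As [xi] and the
    horizontal sections span and both forms are tensorial, [Om = d eta].
    Conversely, if [Om = d eta], what remains in both relations after
    substitution is [eta] applied to a Jacobi sum.

    The Schouten bracket is known only through its axioms, on global sections.
    It agrees with the Lie bracket on sections because the pairing of
    multivectors with decomposable forms is nondegenerate ([pairing_inj],
    [schouten_sections]). It is local because bump functions exist
    ([bump_function], [schouten_near_one]); so a bivector field may be replaced
    near a point by a sum of exterior products of global sections
    ([decomposition_exists]), to which the Leibniz rule applies. Bump functions
    also extend a vector to a global section, on which the pointwise definitions
    of the exterior differential and of the Lie derivative rely. Finally the
    musical map of [(Om, eta)] is invertible because a vector in its kernel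
    annihilates the top form [eta /\ Om^m] ([flat_inj]), and [Pi] is smooth by
    inversion of matrices of smooth functions. *)

(** * Smooth functions on Euclidean space *)

Lemma near_eq_differentiable (R : numFieldType) (V W : normedModType R)
    (f g : V -> W) (a : V) :
  (\near a, f a = g a) -> differentiable f a -> differentiable g a.
Proof.
move=> fg /diff_locallyP[cdf dfE].
have gE : g \o shift a = cst (g a) + 'd f a +o_ 0 id.
  apply/eqaddoP => e e0; move/eqaddoP : dfE => /(_ e e0).
  have fg0 : \forall h \near (0 : V), f (h + a) = g (h + a).
    by move: fg; rewrite (near_shift 0)/=; apply: filterS => h; rewrite subr0.
  rewrite -(nbhs_singleton fg).
  by apply: filterS2 fg0 => h /= fgh; rewrite /= !fctE /= fgh.
apply/diff_locallyP; split; first by rewrite (diff_unique cdf gE).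
by rewrite (diff_unique cdf gE).
Qed.

Section SmoothOn.
Context (R : realType) (n : nat).
Implicit Types (U V : set 'rV[R]_n) (f g : 'rV[R]_n -> R).

(** A coinduction principle: it replaces an explicit formula for the iterated
    derivatives of a product or a composite by the shape of a single one. *)
Lemma smooth_on_coind (S : ('rV[R]_n -> R) -> Prop) U f :
  open U ->
  (forall g, S g ->
     (forall p, U p -> differentiable (g : _ -> R^o) p) /\
     forall v, exists2 h, S h & forall p, U p -> 'D_v (g : _ -> R^o) p = h p) ->
  forall g, S g -> (forall p, U p -> f p = g p) -> smooth_on U f.
Proof.
move=> oU SP h Sh gh vs; elim/last_ind: vs f h Sh gh => [|vs v IH] g h Sh gh p Up.
  apply: (@near_eq_differentiable _ _ _ (h : _ -> R^o)) => /=.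
    near=> q; apply/esym/gh; near: q; exact: open_nbhs_nbhs.
  exact: (SP _ Sh).1.
rewrite foldr_rcons.
have [k Sk kE] := (SP _ Sh).2 v.
apply: (IH _ k) => // q Uq; rewrite -kE//.
apply: near_eq_derive; near=> z; apply: gh; near: z.
exact: open_nbhs_nbhs.
Unshelve. all: by end_near. Qed.

Lemma smooth_on_differentiable U f p :
  smooth_on U f -> U p -> differentiable (f : _ -> R^o) p.
Proof. by move=> /(_ [::]); apply. Qed.

Lemma eq_smooth_on U f g :
  open U -> (forall p, U p -> f p = g p) -> smooth_on U g -> smooth_on U f.
Proof.
move=> oU fg sg; apply: (@smooth_on_coind (smooth_on U) U f oU _ g) => // h sh.
split=> [p Up|v]; first exact: (sh [::]).
exists ('D_v (h : _ -> R^o)) => // vs p Up.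
by have := sh (rcons vs v) p Up; rewrite foldr_rcons.
Qed.

Lemma smooth_on_derive U f v : smooth_on U f -> smooth_on U ('D_v (f : _ -> R^o)).
Proof. by move=> sf vs p Up; have := sf (rcons vs v) p Up; rewrite foldr_rcons. Qed.

Lemma smooth_onS U V f : V `<=` U -> smooth_on U f -> smooth_on V f.
Proof. by move=> VU sf vs p /VU; exact: sf. Qed.

Lemma smooth_on_local U f :
  (forall p, U p -> exists2 V, V p & smooth_on V f) -> smooth_on U f.
Proof. by move=> H vs p /H[V Vp]; exact. Qed.

(** The class to which [smooth_on_coind] is applied. The constructor [SCcomp]
    takes the whole sequence of derivatives of the outer function, so that the
    chain rule stays inside the class. *)
Inductive smooth_closure U : ('rV[R]_n -> R) -> Prop :=
| SCgen f of smooth_on U f : smooth_closure U f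
| SCcst c : smooth_closure U (fun=> c)
| SCadd f g of smooth_closure U f & smooth_closure U g :
    smooth_closure U (fun p => f p + g p)
| SCmul f g of smooth_closure U f & smooth_closure U g :
    smooth_closure U (fun p => f p * g p)
| SCinv f of smooth_closure U f & (forall p, U p -> f p != 0) :
    smooth_closure U (fun p => (f p)^-1)
| SCcomp (phi : nat -> R -> R) k f of
    (forall i (t : R), is_derive t 1 (phi i : _ -> R^o) (phi i.+1 t)) &
    smooth_closure U f : smooth_closure U (fun p => phi k (f p)).

Lemma smooth_closureP U f : open U -> smooth_closure U f -> smooth_on U f.
Proof.
move=> oU cf; apply: (smooth_on_coind oU _ cf) => // {cf}f.
elim=> {f}[f sf|c|f g _ [df Df] _ [dg Dg]|f g cf [df Df] cg [dg Dg]|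
  f cf [df Df] f0|phi k f phiP cf [df Df]].
- split=> [p|v]; first exact: smooth_on_differentiable.
  by exists ('D_v (f : _ -> R^o)) => //; apply: SCgen; exact: smooth_on_derive.
- split=> [p _|v]; first exact: differentiable_cst.
  by exists (fun=> 0); [exact: SCcst|move=> p _; exact: derive_cst].
- split=> [p Up|v]; first by apply: (@differentiableD _ _ _ f g); [exact: df|exact: dg].
  have [f' Sf' f'E] := Df v; have [g' Sg' g'E] := Dg v.
  exists (fun p => f' p + g' p); first exact: SCadd.
  move=> p Up; rewrite -f'E// -g'E//.
  by rewrite -deriveD//; apply: diff_derivable; [exact: df|exact: dg].
- split=> [p Up|v]; first by apply: (@differentiableM _ _ f g); [exact: df|exact: dg].
  have [f' Sf' f'E] := Df v; have [g' Sg' g'E] := Dg v.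
  exists (fun p => f p * g' p + g p * f' p); first by apply: SCadd; exact: SCmul.
  move=> p Up; rewrite -f'E// -g'E//.
  by rewrite -[LHS]/('D_v (f * g) p) deriveM//; apply: diff_derivable; [exact: df|exact: dg].
- split=> [p Up|v].
    by apply: (@differentiableV _ _ f); [exact: df|exact: f0].
  have [f' Sf' f'E] := Df v.
  exists (fun p => (-1) * (((f p)^-1 * (f p)^-1) * f' p)).
    apply: SCmul; first exact: SCcst.
    by apply: SCmul => //; apply: SCmul; exact: SCinv.
  move=> p Up; rewrite -f'E//.
  rewrite (@deriveV _ _ f) ?f0//; last by apply: diff_derivable; exact: df.
  by rewrite mulN1r -expr2 exprVn scaleNr.
- have dphi i t : differentiable (phi i : R -> R^o) t.
    by apply/derivable1_diffP; have [] := phiP i t.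
  split=> [p Up|v].
    exact: (@differentiable_comp _ _ _ _ (f : _ -> R^o) (phi k : R^o -> R^o) p
      (df _ Up) (dphi _ _)).
  have [f' Sf' f'E] := Df v.
  exists (fun p => phi k.+1 (f p) * f' p).
    by apply: SCmul => //; exact: SCcomp.
  move=> p Up; rewrite -f'E//.
  have dfp := df _ Up.
  rewrite -[LHS]/('D_v ((phi k : R^o -> R^o) \o (f : _ -> R^o)) p).
  rewrite (deriveE _ (differentiable_comp dfp (dphi _ _))) diff_comp//=.
  rewrite (deriveE _ dfp) -[X in 'd _ _ X = _]mulr1.
  rewrite -[X in 'd _ _ X = _]/('d (f : _ -> R^o) p v *: (1 : R^o)) linearZ/=.
  have := phiP k (f p) => -[_ <-]; rewrite deriveE//; exact: mulrC.
Qed.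

End SmoothOn.

(** * Flat functions and cutoffs *)

Section FlatFunction.
Context (R : realType).
Implicit Types (Q : {poly R}) (s t : R).

(** Each monomial is dominated by one term of the exponential series. *)
Lemma horner_le_expR Q : exists C, forall s, 0 <= s -> `|Q.[s]| <= C * expR s.
Proof.
exists (\sum_(i < size Q) `|Q`_i| * i`!%:R) => s s0.
rewrite horner_coef (le_trans (ler_norm_sum _ _ _))// mulr_suml.
apply: ler_sum => i _; rewrite normrM -mulrA ler_wpM2l//.
rewrite ger0_norm ?exprn_ge0//.
have fp (k : nat) : 0 < k`!%:R :> R by rewrite ltr0n fact_gt0.
case: (i : nat) => [|k].
  by rewrite expr0 fact0 mul1r (le_trans _ (expR_ge1Dx s))// lerDl.
rewrite mulrC -ler_pdivrMr//.
by apply: le_trans (expR_ge1Dxn k s0); rewrite lerDr.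
Qed.

(** The derivatives of [exp (- 1 / t)], extended by [0] for [t <= 0], all have
    this form. *)
Definition flat_fun Q t : R := if 0 < t then Q.[t^-1] * expR (- t^-1) else 0.

(** Quadratic decay at [0] is all that differentiability there requires. *)
Lemma flat_fun_sqr_le Q : exists2 C, 0 <= C & forall t, `|flat_fun Q t| <= C * t ^+ 2.
Proof.
have [C QC] := horner_le_expR ('X^2 * Q).
have C0 : 0 <= C.
  have := QC 0 (lexx 0); rewrite expR0 mulr1; exact: le_trans.
exists C => // t; rewrite /flat_fun; case: ifPn => [t0|_]; last first.
  by rewrite normr0 mulr_ge0// sqr_ge0.
have tV0 : 0 <= t^-1 by rewrite invr_ge0 ltW.
have := QC _ tV0; rewrite hornerM hornerXn normrM (ger0_norm (exprn_ge0 _ tV0)).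
rewrite exprVn -ler_pdivlMl ?invr_gt0 ?exprn_gt0// invrK => H.
rewrite normrM (ger0_norm (expR_ge0 _)) expRN ler_pdivrMr ?expR_gt0//.
by rewrite (le_trans H)// mulrCA mulrA.
Qed.

Definition flat_step Q : {poly R} := 'X^2 * (Q - Q^`()).

Lemma is_derive_flat_fun Q t :
  is_derive t 1 (flat_fun Q : R -> R^o) (flat_fun (flat_step Q) t).
Proof.
have [t0|t0|t0] := ltgtP t 0.
- rewrite [flat_fun (flat_step Q) t]/flat_fun ltNge (ltW t0)/=.
  apply: (@near_eq_is_derive _ _ _ (cst 0 : R -> R^o)).
    near=> z; rewrite /flat_fun /cst; case: ifP => // z0.
    have : z < 0 by near: z; exact: lt_nbhsl.
    by move=> /(lt_trans z0); rewrite ltxx.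
- rewrite [flat_fun (flat_step Q) t]/flat_fun t0.
  apply: (@near_eq_is_derive _ _ _ ((fun z : R => Q.[z^-1] * expR (- z^-1)) : R -> R^o)).
    near=> z; rewrite /flat_fun; case: ifPn => // /negP[].
    by near: z; exact: lt_nbhsr.
  have tn0 : t != 0 by rewrite gt_eqF.
  have dV : is_derive t 1 (fun z : R => z^-1 : R^o) (- t^-2).
    apply: is_derive_eq (is_deriveV (f := id) tn0 (is_derive_id t 1)) _.
    by rewrite [_ *: _]mulr1.
  have dQ : is_derive t 1 (fun z => Q.[z^-1] : R^o) (Q^`().[t^-1] * - t^-2).
    exact: (@is_derive1_comp _ (horner Q) (fun z : R => z^-1)).
  have dE : is_derive t 1 (fun z => expR (- z^-1) : R^o) (expR (- t^-1) * t^-2).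
    apply: (@is_derive1_comp _ expR (fun z : R => - z^-1)).
    by rewrite -[t^-2]opprK; exact: is_deriveN.
  apply: is_derive_eq (is_deriveM dQ dE) _.
  rewrite /flat_step hornerM hornerXn hornerD hornerN exprVn.
  by rewrite /GRing.scale/=; ring.
- rewrite t0 /flat_fun ltxx -/(flat_fun Q).
  have [C C0 QC] := flat_fun_sqr_le Q.
  have H : (fun h : R => h^-1 *: (flat_fun Q (h *: 1 + 0) - flat_fun Q 0) : R^o)
      @ 0^' --> (0 : R^o).
    apply/cvgr0Pnorm_le => e e0.
    near=> h.
    have h0 : h != 0 by near: h; exact: nbhs_dnbhs_neq.
    rewrite addr0 [X in _ - X]/flat_fun ltxx subr0 normrM normfV ler_pdivrMl ?normr_gt0//.
    rewrite [_ *: 1]mulr1 (le_trans (QC _))//.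
    rewrite -[h ^+ 2]real_normK ?num_real// expr2 mulrCA ler_wpM2l//.
    have : `|h| <= e / (C + 1).
      near: h; apply: dnbhs0_le; rewrite divr_gt0// ltr_wpDl//.
    rewrite ler_pdivlMr ?ltr_wpDl// => He; apply: le_trans He.
    by rewrite mulrC ler_wpM2l// lerDl.
  apply: DeriveDef; first by apply/cvg_ex; exists 0.
  exact: (cvg_lim _ H).
Unshelve. all: by end_near. Qed.

Lemma flat_fun1_ge0 t : 0 <= flat_fun 1 t.
Proof. by rewrite /flat_fun hornerC mul1r; case: ifP => // _; exact: expR_ge0. Qed.

Lemma flat_fun1_gt0 t : 0 < t -> 0 < flat_fun 1 t.
Proof. by move=> t0; rewrite /flat_fun t0 hornerC mul1r expR_gt0. Qed.

Lemma flat_fun_le0 Q t : t <= 0 -> flat_fun Q t = 0.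
Proof. by rewrite /flat_fun leNgt => /negbTE->. Qed.

(** A smooth step from [0], for [t <= 0], to [1], for [1 <= t]. *)
Definition cutoff t : R := flat_fun 1 t * (flat_fun 1 t + flat_fun 1 (1 - t))^-1.

Lemma cutoff_denom_neq0 t : flat_fun 1 t + flat_fun 1 (1 - t) != 0.
Proof.
rewrite gt_eqF//; have [t0|t0] := ltP 0 t.
  by rewrite ltr_wpDr ?flat_fun1_ge0 ?flat_fun1_gt0.
by rewrite ltr_wpDl ?flat_fun1_ge0 ?flat_fun1_gt0// subr_gt0 (le_lt_trans t0).
Qed.

Lemma cutoff_le0 t : t <= 0 -> cutoff t = 0.
Proof. by move=> t0; rewrite /cutoff flat_fun_le0// mul0r. Qed.

Lemma cutoff_ge1 t : 1 <= t -> cutoff t = 1.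
Proof.
move=> t1; rewrite /cutoff (@flat_fun_le0 1 (1 - t)) ?subr_le0// addr0 divff//.
by rewrite gt_eqF// flat_fun1_gt0// (lt_le_trans ltr01).
Qed.

Lemma smooth_closure_cutoff n (U : set 'rV[R]_n) f :
  smooth_closure U f -> smooth_closure U (fun p => cutoff (f p)).
Proof.
move=> cf; pose phi k := flat_fun (iter k flat_step 1).
have phiP i t : is_derive t 1 (phi i : _ -> R^o) (phi i.+1 t).
  exact: is_derive_flat_fun.
have cphi g : smooth_closure U g -> smooth_closure U (fun p => flat_fun 1 (g p)).
  exact: (@SCcomp _ _ _ phi 0%N).
apply: SCmul; first exact: cphi.
apply: (@SCinv _ _ _ (fun p => flat_fun 1 (f p) + flat_fun 1 (1 - f p))).
  apply: SCadd; apply: cphi => //.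
  have -> : (fun p => 1 - f p) = (fun p => 1 + (-1) * f p).
    by apply/funext=> p; rewrite mulN1r.
  by apply: SCadd; [exact: SCcst|apply: SCmul => //; exact: SCcst].
by move=> p _; exact: cutoff_denom_neq0.
Qed.

End FlatFunction.

Lemma smooth_closure_sum (R : realType) n (U : set 'rV[R]_n) (I : Type)
    (s : seq I) (F : I -> 'rV[R]_n -> R) :
  (forall i, smooth_closure U (F i)) ->
  smooth_closure U (fun p => \sum_(i <- s) F i p).
Proof.
move=> SF; elim: s => [|i s IH].
  by under eq_fun do rewrite big_nil; exact: SCcst.
by under eq_fun do rewrite big_cons; exact: SCadd.
Qed.

Lemma smooth_closure_coord (R : realType) n (U : set 'rV[R]_n) k :
  open U -> smooth_closure U (fun p => p ord0 k).
Proof.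
move=> oU; apply: SCgen.
pose S (g : 'rV[R]_n -> R) := g = (fun p => p ord0 k) \/ exists c, g = fun=> c.
apply: (@smooth_on_coind _ _ S _ _ oU _ _ (or_introl erefl)) => // _ [->|[c ->]].
  have dk p : differentiable ((fun q : 'rV[R]_n => q ord0 k) : _ -> R^o) p.
    exact: differentiable_coord.
  split=> [p _|v]; first exact: dk.
  exists (fun=> v ord0 k); first by right; exists (v ord0 k).
  move=> p _; have /matrixP/(_ ord0 k) := derive_mx (@derivable_id _ _ p v).
  by rewrite mxE derive_id.
split=> [p _|v]; first exact: differentiable_cst.
by exists (fun=> 0); [right; exists 0|move=> p _; exact: derive_cst].
Qed.

(** * Smooth functions on a manifold and bump functions *)

Section SmoothFunOn.
Context (R : realType) (n : nat) (M : manifold R n).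
Implicit Types (U V W : set M) (f g : M -> R) (c : chart M) (x y : M).

Lemma chart_image_open c U : open U -> open (cmap c @` (cdom c `&` U)).
Proof.
move=> oU.
have -> : cmap c @` (cdom c `&` U) = (cmap c @` cdom c) `&` cinv c @^-1` U.
  apply/seteqP; split => p.
    by move=> [x [cx Ux] <-]; split; [exists x|rewrite /= cmapK].
  by move=> [[x cx <-]] /=; rewrite cmapK// => Ux; exists x.
rewrite openE => p [Cp Up].
have : nbhs p (cmap c @` cdom c) by apply: open_nbhs_nbhs; split=> //; exact: cimg_open.
have : nbhs p (cinv c @^-1` U).
  by apply: (cinv_continuous Cp); apply: open_nbhs_nbhs; split.
by move=> nU nC; rewrite /interior/=; exact: filterI nC nU.
Qed.

Lemma smooth_fun_onS U V f : V `<=` U -> smooth_fun_on U f -> smooth_fun_on V f.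
Proof.
by move=> VU sf c; apply: smooth_onS (sf c); apply: image_subset; exact: setIS.
Qed.

Lemma smooth_fun_on_local U f :
  (forall x, U x -> exists2 V, V x & smooth_fun_on V f) -> smooth_fun_on U f.
Proof.
move=> H c; apply: smooth_on_local => _ [x [cx Ux] <-].
have [V Vx sV] := H _ Ux.
by exists (cmap c @` (cdom c `&` V)); [exists x|exact: sV].
Qed.

Lemma smooth_closure_fun_on U f : open U ->
  (forall c, smooth_closure (cmap c @` (cdom c `&` U)) (fun p => f (cinv c p))) ->
  smooth_fun_on U f.
Proof. by move=> oU H c; apply: smooth_closureP; [exact: chart_image_open|exact: H]. Qed.

Lemma eq_smooth_fun_on U f g :
  open U -> (forall x, U x -> f x = g x) -> smooth_fun_on U g -> smooth_fun_on U f.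
Proof.
move=> oU fg sg c; apply: (eq_smooth_on _ _ (sg c)); first exact: chart_image_open.
by move=> _ [x [cx Ux] <-]; rewrite cmapK//; exact: fg.
Qed.

Lemma smooth_fun_on_cst U r : open U -> smooth_fun_on U (fun=> r).
Proof. by move=> oU; apply: smooth_closure_fun_on => // c; exact: SCcst. Qed.

Lemma smooth_fun_onD U f g : open U ->
  smooth_fun_on U f -> smooth_fun_on U g -> smooth_fun_on U (fun x => f x + g x).
Proof.
move=> oU sf sg; apply: smooth_closure_fun_on => // c.
by apply: SCadd; apply: SCgen; [exact: sf|exact: sg].
Qed.

Lemma smooth_fun_onM U f g : open U ->
  smooth_fun_on U f -> smooth_fun_on U g -> smooth_fun_on U (fun x => f x * g x).
Proof.
move=> oU sf sg; apply: smooth_closure_fun_on => // c.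
by apply: SCmul; apply: SCgen; [exact: sf|exact: sg].
Qed.

Lemma smooth_fun_onV U f : open U -> (forall x, U x -> f x != 0) ->
  smooth_fun_on U f -> smooth_fun_on U (fun x => (f x)^-1).
Proof.
move=> oU f0 sf; apply: smooth_closure_fun_on => // c.
apply: (@SCinv _ _ _ (fun p => f (cinv c p))); first by apply: SCgen; exact: sf.
by move=> _ [x [cx Ux] <-]; rewrite cmapK//; exact: f0.
Qed.

Lemma smooth_fun_onN U f : open U ->
  smooth_fun_on U f -> smooth_fun_on U (fun x => - f x).
Proof.
move=> oU sf; have -> : (fun x => - f x) = (fun x => (-1) * f x).
  by apply/funext => x; rewrite mulN1r.
by apply: smooth_fun_onM => //; exact: smooth_fun_on_cst.
Qed.

Lemma smooth_fun_on_sum U (I : Type) (s : seq I) (P : pred I) (F : I -> M -> R) :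
  open U -> (forall i, P i -> smooth_fun_on U (F i)) ->
  smooth_fun_on U (fun x => \sum_(i <- s | P i) F i x).
Proof.
move=> oU sF; elim: s => [|i s IH].
  by under eq_fun do rewrite big_nil; exact: smooth_fun_on_cst.
apply: (@eq_smooth_fun_on _ _ (fun x =>
    if P i then F i x + \sum_(j <- s | P j) F j x else \sum_(j <- s | P j) F j x)) => //.
  by move=> x _; rewrite big_cons.
by case: (boolP (P i)) => // Pi; apply: smooth_fun_onD => //; exact: sF.
Qed.

Lemma smooth_fun_on_prod U (I : Type) (s : seq I) (P : pred I) (F : I -> M -> R) :
  open U -> (forall i, P i -> smooth_fun_on U (F i)) ->
  smooth_fun_on U (fun x => \prod_(i <- s | P i) F i x).
Proof.
move=> oU sF; elim: s => [|i s IH].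
  by under eq_fun do rewrite big_nil; exact: smooth_fun_on_cst.
apply: (@eq_smooth_fun_on _ _ (fun x =>
    if P i then F i x * \prod_(j <- s | P j) F j x else \prod_(j <- s | P j) F j x)) => //.
  by move=> x _; rewrite big_cons.
by case: (boolP (P i)) => // Pi; apply: smooth_fun_onM => //; exact: sF.
Qed.

(** In a chart, the cutoff is composed with a function of the distance to [x].
    Its support is the image of a compact box, which is closed as the manifold
    is Hausdorff, so that the extension by [0] is smooth. *)
Lemma bump_function W x : open W -> W x ->
  exists f : M -> R, [/\ smooth_fun f,
    exists V, [/\ open V, V x & forall y, V y -> f y = 1] &
    exists K, [/\ closed K, K `<=` W & forall y, ~ K y -> f y = 0]].
Proof.
move=> oW Wx; have [c cx] := cdom_cover x.
pose p0 := cmap c x.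
have : nbhs p0 (cmap c @` (cdom c `&` W)).
  by apply: open_nbhs_nbhs; split; [exact: chart_image_open|exists x].
move=> /nbhs_ballP[e0 /= e0_gt0 e0W].
pose e := e0 / 2; have e_gt0 : 0 < e by rewrite divr_gt0.
have ee0 : e < e0 by rewrite /e; lra.
pose box := [set q : 'rV[R]_n | forall i, q ord0 i \in `[p0 ord0 i - e, p0 ord0 i + e]].
have boxW : box `<=` cmap c @` (cdom c `&` W).
  move=> q bq; apply: e0W; split=> // i j.
  rewrite [i]ord1 /ball/= (le_lt_trans _ ee0)// distrC ler_distl.
  by have := bq j; rewrite in_itv.
have cbox : compact box.
  apply: (@rV_compact R n (fun i => `[p0 ord0 i - e, p0 ord0 i + e]%classic)) => i.
  exact: segment_compact.
pose K := cinv c @` box.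
have KW : K `<=` cdom c `&` W.
  by move=> _ [q /boxW [y [cy Wy] <-] <-]; rewrite cmapK.
have cK : closed K.
  apply: compact_closed; first exact: m_hausdorff.
  apply: continuous_compact => //.
  apply: continuous_in_subspaceT => q /set_mem /boxW[y [cy _] <-].
  by apply: cinv_continuous; exists y.
(* [u] is positive only inside the box, and equals [2] at the centre, so that
   [cutoff \o u] is [1] around it *)
pose S (q : 'rV[R]_n) := \sum_(i < n) (q ord0 i - p0 ord0 i) ^+ 2.
pose u (q : 'rV[R]_n) := 2 + - 2 / e ^+ 2 * S q.
have Scl (N : set 'rV[R]_n) (a : 'rV[R]_n -> 'rV[R]_n) :
    (forall k, smooth_closure N (fun p => a p ord0 k)) ->
    smooth_closure N (fun p => u (a p)).
  move=> ak; apply: SCadd; first exact: SCcst.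
  apply: SCmul; first exact: SCcst.
  apply: smooth_closure_sum => i.
  have -> : (fun p => (a p ord0 i - p0 ord0 i) ^+ 2) =
            (fun p => (a p ord0 i + - p0 ord0 i) * (a p ord0 i + - p0 ord0 i)).
    by apply/funext => p; rewrite expr2.
  by apply: SCmul; apply: SCadd => //; exact: SCcst.
pose f y := if y \in cdom c then cutoff (u (cmap c y)) else 0.
have f0 y : ~ K y -> f y = 0.
  move=> Ky; rewrite /f; case: ifPn => // /set_mem cy.
  apply: cutoff_le0; rewrite leNgt; apply/negP => u0; apply: Ky.
  exists (cmap c y); last by rewrite cmapK.
  move=> i; rewrite in_itv/= -ler_distl -(ler_pXn2r (ltn0Sn 1)) ?nnegrE ?(ltW e_gt0)//.
  rewrite real_normK ?num_real//.
  have e2 : 0 < e ^+ 2 by rewrite exprn_gt0.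
  have Se : S (cmap c y) < e ^+ 2.
    move: u0; rewrite /u mulNr -mulNr mulrAC.
    rewrite -(ltr_pM2r e2) mul0r mulrDl mulfVK ?gt_eqF//; lra.
  apply: le_trans (ltW Se).
  by rewrite /S (bigD1 i)//= lerDl sumr_ge0// => j _; exact: sqr_ge0.
exists f; split.
- apply: smooth_fun_on_local => y _.
  have [cy|cy] := pselect (cdom c y).
    exists (cdom c) => //; apply: (@eq_smooth_fun_on _ _ (fun z => cutoff (u (cmap c z)))).
    + exact: cdom_open.
    + by move=> z cz; rewrite /f mem_set.
    + apply: smooth_closure_fun_on; first exact: cdom_open.
      move=> d; apply: smooth_closure_cutoff; apply: Scl => k.
      by apply: SCgen; exact: chart_compat.
  exists (~` K); first by move=> /KW[].
  apply: (@eq_smooth_fun_on _ _ (fun=> 0)) => //; first exact: closed_openC.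
  exact/smooth_fun_on_cst/closed_openC.
- have su : smooth_on setT u.
    apply: smooth_closureP; first exact: openT.
    by apply: (Scl _ id) => k; apply: smooth_closure_coord; exact: openT.
  have cu : {for p0, continuous (u : _ -> R^o)}.
    by apply: differentiable_continuous; exact: (su [::]).
  have u_p0 : u p0 = 2.
    by rewrite /u /S big1 ?mulr0 ?addr0// => i _; rewrite subrr expr0n.
  have nu : nbhs p0 [set q | 1 < u q].
    by apply: (cu [set r | 1 < r]); apply: lt_nbhsr; rewrite u_p0; lra.
  exists (cdom c `&` cmap c @^-1` [set q | 1 < u q])°; split.
  + exact: open_interior.
  + apply: filterI; last exact: (cmap_continuous cx).
    by apply: open_nbhs_nbhs; split=> //; exact: cdom_open.
  + move=> y /interior_subset[cy u1]; rewrite /f mem_set//.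
    by apply: cutoff_ge1; exact: ltW.
- by exists K; split => //; move=> y /KW[].
Qed.

End SmoothFunOn.

(** * Exterior products of alternating maps *)

Section Wedge.
Context (R : realType) (T : Type).
Implicit Types (w : seq T -> R) (s t : seq T) (v : T).

Lemma wedge_nil w1 w2 : wedge w1 w2 [::] = w1 [::] * w2 [::].
Proof.
rewrite /wedge (big_pred1 [tuple])/=; last first.
  by move=> m; apply/esym/eqP; rewrite [LHS]tuple0 [RHS]tuple0.
by rewrite /shuffle_inv big_ord0 expr0 mul1r.
Qed.

Lemma shuffle_inv_cons k (b : bool) (m : k.-tuple bool) :
  shuffle_inv [tuple of b :: m] = (~~ b * count id m + shuffle_inv m)%N.
Proof.
rewrite /shuffle_inv big_ord_recl; congr (_ + _)%N.
  rewrite big_mkcond big_ord_recl/= add0n.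
  have -> : count id m = (\sum_(i < k) tnth m i)%N.
    by rewrite -sum1_count big_mkcond/= big_tuple; apply: eq_bigr => i _; case: (tnth m i).
  rewrite big_distrr/=; apply: eq_bigr => i _.
  by rewrite tnthS tnth0; case: b; case: (tnth m i).
apply: eq_bigr => i _; rewrite big_mkcond big_ord_recl/= add0n [RHS]big_mkcond.
by apply: eq_bigr => j _; rewrite !tnthS.
Qed.

(** The head [v] goes to the first factor, or jumps over all the arguments of
    the first factor to reach the second one: hence the sign. *)
Lemma wedge_cons w1 w2 v s :
  wedge w1 w2 (v :: s) =
    wedge (fun t => w1 (v :: t)) w2 s
    + wedge (fun t => (-1) ^+ size t * w1 t) (fun t => w2 (v :: t)) s.
Proof.
rewrite /wedge /=.
pose h (p : bool * (size s).-tuple bool) : (size s).+1.-tuple bool := [tuple of p.1 :: p.2].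
rewrite (reindex h)/=; last first.
  exists (fun m => (thead m, [tuple of behead m])).
    by move=> [b m] _ /=; rewrite /h/= theadE; congr pair; apply/val_inj.
  by move=> m _; rewrite /h/=; case/tupleP: m => b m; apply/val_inj; rewrite /= theadE.
rewrite -(pair_bigA _ (fun b m => (-1) ^+ shuffle_inv (h (b, m)) * w1 (mask (h (b, m)) (v :: s))
   * w2 (mask (map negb (h (b, m))) (v :: s))))/=.
rewrite big_bool/=; congr (_ + _); apply: eq_bigr => m _; rewrite /h shuffle_inv_cons/=.
  by rewrite mul0n add0n.
rewrite size_mask ?size_tuple// mul1n exprD; ring.
Qed.

Lemma eq_wedge w1 w1' w2 w2' s :
  w1 =1 w1' -> w2 =1 w2' -> wedge w1 w2 s = wedge w1' w2' s.
Proof. by move=> E1 E2; apply: eq_bigr => m _; rewrite E1 E2. Qed.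

Lemma wedge_eq0l w1 w2 s :
  (forall m : bitseq, size m = size s -> w1 (mask m s) = 0) -> wedge w1 w2 s = 0.
Proof. by move=> H; apply: big1 => m _; rewrite H ?size_tuple// mulr0 mul0r. Qed.

Lemma wedge_eq0r w1 w2 s :
  (forall m : bitseq, size m = size s -> w2 (mask m s) = 0) -> wedge w1 w2 s = 0.
Proof. by move=> H; apply: big1 => m _; rewrite H ?mulr0// size_map size_tuple. Qed.

Lemma wedge_linearl c w w' w2 s :
  wedge (fun t => c * w t + w' t) w2 s = c * wedge w w2 s + wedge w' w2 s.
Proof.
rewrite /wedge mulr_sumr -big_split; apply: eq_bigr => m _ /=; ring.
Qed.

Lemma wedge_linearr c w w' w1 s :
  wedge w1 (fun t => c * w t + w' t) s = c * wedge w1 w s + wedge w1 w' s.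
Proof.
rewrite /wedge mulr_sumr -big_split; apply: eq_bigr => m _ /=; ring.
Qed.

Lemma wedge_homogeneous k l w1 w2 :
  homogeneous k w1 -> homogeneous l w2 -> homogeneous (k + l) (wedge w1 w2).
Proof.
move=> h1 h2 s skl; apply: big1 => m _.
have [k1|k1] := eqVneq (size (mask m s)) k; last by rewrite h1// mulr0 mul0r.
rewrite h2 ?mulr0//; apply: contraNN skl => /eqP l1.
have sm : size (mask m s) = count id m by rewrite size_mask// size_tuple.
have smn : size (mask (map negb m) s) = count (predC id) m.
  by rewrite size_mask ?size_map ?size_tuple// count_map.
by rewrite -k1 -l1 sm smn count_predC size_tuple.
Qed.

Lemma wedge_scalarl c w s : wedge (fun t => c * (nilp t)%:R) w s = c * w s.
Proof.
elim: s c w => [|v s IH] c w; first by rewrite wedge_nil mulr1.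
rewrite wedge_cons wedge_eq0l ?add0r => [|m _]; last by rewrite mulr0.
rewrite -(IH c (fun t => w (v :: t))); apply: eq_wedge => // t.
by case: t => [|? ?]/=; rewrite ?expr0 ?mul1r// !mulr0.
Qed.

Lemma wedge_scalarr c w s : wedge w (fun t => c * (nilp t)%:R) s = c * w s.
Proof.
elim: s c w => [|v s IH] c w; first by rewrite wedge_nil mulr1 mulrC.
rewrite wedge_cons [X in _ + X]wedge_eq0r ?addr0 => [|m _]; last by rewrite mulr0.
exact: IH.
Qed.

End Wedge.

Section Alternating.
Context (R : realType) (V : vectType R).
Implicit Types (w : seq V -> R) (s t : seq V) (u v : V).

Definition multilinear_fun w := forall s t (c : R) u v,
  w (s ++ (c *: u + v) :: t) = c * w (s ++ u :: t) + w (s ++ v :: t).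

Lemma multilinear_fun0 w s t : multilinear_fun w -> w (s ++ 0 :: t) = 0.
Proof. by move=> /(_ s t (-1) 0 0); rewrite scaler0 addr0 mulN1r addNr. Qed.

Lemma multilinear_funZ w s t c u :
  multilinear_fun w -> w (s ++ c *: u :: t) = c * w (s ++ u :: t).
Proof. by move=> mw; have := mw s t c u 0; rewrite addr0 multilinear_fun0// addr0. Qed.

Lemma multilinear_funD w s t u v :
  multilinear_fun w -> w (s ++ (u + v) :: t) = w (s ++ u :: t) + w (s ++ v :: t).
Proof. by move=> mw; have := mw s t 1 u v; rewrite scale1r mul1r. Qed.

Lemma multilinear_fun_sum w s t (I : Type) (r : seq I) (F : I -> V) :
  multilinear_fun w ->
  w (s ++ (\sum_(i <- r) F i) :: t) = \sum_(i <- r) w (s ++ F i :: t).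
Proof.
move=> mw; elim: r => [|i r IH]; first by rewrite !big_nil multilinear_fun0.
by rewrite !big_cons multilinear_funD// IH.
Qed.

Lemma multilinear_fun_cons w v : multilinear_fun w -> multilinear_fun (fun t => w (v :: t)).
Proof. by move=> mw s t c u u'; exact: (mw (v :: s)). Qed.

Lemma multilinear_fun_sign w :
  multilinear_fun w -> multilinear_fun (fun t => (-1) ^+ size t * w t).
Proof. by move=> mw s t c u u'; rewrite mw !size_cat/=; ring. Qed.

(** By polarisation [w] changes sign under adjacent transpositions, which bring
    any two equal arguments next to each other. *)
Lemma alternating_of_adjacent w : multilinear_fun w ->
  (forall s u t, w (s ++ u :: u :: t) = 0) -> alternating w.
Proof.
move=> mw adj; split=> // s0.
have swap p u v t : w (p ++ u :: v :: t) = - w (p ++ v :: u :: t).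
  have := adj p (u + v) t; rewrite multilinear_funD//.
  have E a : p ++ a :: (u + v) :: t = rcons p a ++ (u + v) :: t by rewrite cat_rcons.
  by rewrite !E !multilinear_funD// !cat_rcons !adj add0r addr0 => /eqP; rewrite addr_eq0 => /eqP.
suff : forall s p, ~~ uniq s -> w (p ++ s) = 0 by move=> H; exact: (H s0 [::]).
elim=> // v s IH p; rewrite /= negb_and negbK => /orP[|us]; last first.
  by rewrite -cat_rcons IH.
move=> /splitPr[p1 p2] {IH s}.
elim: p1 p => [|x p1 IH] p; first exact: adj.
by rewrite /= swap -cat_rcons IH oppr0.
Qed.

Lemma alternating_swap w s t u v :
  alternating w -> w (s ++ u :: v :: t) = - w (s ++ v :: u :: t).
Proof.
move=> [mw aw].
have adj p a : w (p ++ a :: a :: t) = 0.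
  by apply: aw; rewrite cat_uniq/= inE eqxx/= !andbF.
have := adj s (u + v); rewrite multilinear_funD//.
have E a : s ++ a :: (u + v) :: t = rcons s a ++ (u + v) :: t by rewrite cat_rcons.
rewrite !E !multilinear_funD// !cat_rcons !adj add0r addr0 => /eqP.
by rewrite addr_eq0 => /eqP.
Qed.

Lemma alternating_cons w v : alternating w -> alternating (fun t => w (v :: t)).
Proof.
move=> [mw aw]; split; first exact: multilinear_fun_cons.
by move=> s us; apply: aw; rewrite /= negb_and us orbT.
Qed.

Lemma alternating_sign w : alternating w -> alternating (fun t => (-1) ^+ size t * w t).
Proof.
move=> [mw aw]; split; first exact: multilinear_fun_sign.
by move=> s us; rewrite aw// mulr0.
Qed.

Lemma alternating_comb c w w' : alternating w -> alternating w' ->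
  alternating (fun s => c * w s + w' s).
Proof.
move=> [mw aw] [mw' aw']; split; first by move=> s t d u v; rewrite mw mw'; ring.
by move=> s us; rewrite aw// aw'// mulr0 addr0.
Qed.

(** Induction on the position of the argument: [wedge_cons] strips the arguments
    in front of it. *)
Lemma multilinear_fun_wedge w1 w2 :
  multilinear_fun w1 -> multilinear_fun w2 -> multilinear_fun (wedge w1 w2).
Proof.
move=> m1 m2 s t c u v; elim: s w1 w2 m1 m2 => [|x s IH] w1 w2 m1 m2 /=.
  rewrite !wedge_cons.
  have -> : (fun t => w1 ((c *: u + v) :: t)) = (fun t => c * w1 (u :: t) + w1 (v :: t)).
    by apply/funext => z; exact: (m1 [::]).
  have -> : (fun t => w2 ((c *: u + v) :: t)) = (fun t => c * w2 (u :: t) + w2 (v :: t)).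
    by apply/funext => z; exact: (m2 [::]).
  rewrite wedge_linearl wedge_linearr; ring.
rewrite !wedge_cons !IH; try exact: multilinear_fun_cons;
  try exact: multilinear_fun_sign; try by [].
ring.
Qed.

Lemma alternating_wedge w1 w2 :
  alternating w1 -> alternating w2 -> alternating (wedge w1 w2).
Proof.
move=> a1 a2; apply: alternating_of_adjacent.
  by apply: multilinear_fun_wedge; [case: a1|case: a2].
move=> s u t; elim: s w1 w2 a1 a2 => [|x s IH] w1 w2 a1 a2 /=; last first.
  by rewrite wedge_cons !IH ?addr0//; do ?exact: alternating_cons; exact: alternating_sign.
have z1 p : w1 (u :: u :: p) = 0 by apply: a1.2; rewrite /= inE eqxx.
have z2 p : w2 (u :: u :: p) = 0 by apply: a2.2; rewrite /= inE eqxx.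
rewrite !wedge_cons (wedge_eq0l _ (w1 := fun t => w1 [:: u, u & t])) ?add0r;
  last by move=> m _; exact: z1.
rewrite [X in _ + (_ + X)]wedge_eq0r ?addr0 => [|m _]; last exact: z2.
rewrite -[X in X + _]mul1r -wedge_linearl.
by apply: wedge_eq0l => m _ /=; rewrite exprS mul1r; ring.
Qed.

Lemma alternating_nilp : alternating (fun s : seq V => (nilp s)%:R : R).
Proof.
by split=> [s t c u v|[]//]; rewrite /nilp !size_cat/= !addnS mulr0 addr0.
Qed.

Lemma alternating_perm0 w s t :
  alternating w -> perm_eq s t -> w s = 0 -> w t = 0.
Proof.
move=> aw; have move_front p v t1 t2 : w (p ++ v :: t1 ++ t2) = 0 -> w (p ++ t1 ++ v :: t2) = 0.
  elim: t1 p => // x t1 IH p H /=; rewrite -cat_rcons IH// cat_rcons.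
  by apply/eqP; rewrite -oppr_eq0 -alternating_swap//; apply/eqP.
suff : forall s t p, perm_eq s t -> w (p ++ s) = 0 -> w (p ++ t) = 0.
  by move=> H; exact: (H s t [::]).
elim=> {s t}[|v s IH] t p st; first by move: st; rewrite perm_sym => /perm_nilP->.
have : v \in t by rewrite -(perm_mem st) mem_head.
move=> /splitPr tE; case: tE st => t1 t2 st H; apply: move_front.
rewrite -cat_rcons; apply: IH; last by rewrite cat_rcons.
by rewrite -(perm_cons v) (perm_trans st)// perm_catC/= perm_cons perm_catC.
Qed.

(** The prefix of spanning vectors grows by expanding one argument at a time. *)
Lemma multilinear_fun_spanned0 w (I : finType) (X : I -> V) :
  multilinear_fun w -> (forall v, exists c : I -> R, v = \sum_i c i *: X i) ->
  (forall l : seq I, w (map X l) = 0) -> forall s, w s = 0.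
Proof.
move=> mw sp w0 s; suff: forall t l, w (map X l ++ t) = 0 by move=> /(_ s [::]).
elim=> [|v t IH] l; first by rewrite cats0.
have [c ->] := sp v; rewrite multilinear_fun_sum// big1// => i _.
by rewrite multilinear_funZ// -cat_rcons -map_rcons IH mulr0.
Qed.

(** A list of spanning vectors either has a repetition or is, up to a sign,
    increasing in the index. *)
Lemma alternating_spanned0 w n (X : 'I_n -> V) :
  alternating w -> (forall v, exists c : 'I_n -> R, v = \sum_i c i *: X i) ->
  (forall J : {set 'I_n}, w [seq X i | i <- enum J] = 0) -> forall s, w s = 0.
Proof.
move=> aw sp w0; apply: (multilinear_fun_spanned0 aw.1 sp) => l.
have [ul|nul] := boolP (uniq l); last first.
  by apply: aw.2; apply: contra nul; exact: map_uniq.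
apply: (alternating_perm0 aw _ (w0 [set i in l])); apply: perm_map.
apply: uniq_perm => //; first exact: enum_uniq.
by move=> i; rewrite mem_enum inE.
Qed.

(** For an alternating [w], this says that the interior product of [w] with [v]
    is zero. *)
Definition annihilates v w := forall s, v \in s -> w s = 0.

Lemma annihilates_wedge v w1 w2 :
  annihilates v w1 -> annihilates v w2 -> annihilates v (wedge w1 w2).
Proof.
move=> n1 n2 s; elim: s w1 w2 n1 n2 => // x s IH w1 w2 n1 n2.
rewrite inE wedge_cons => /predU1P[<-|vs].
  rewrite wedge_eq0l => [|m _]; last by rewrite n1// mem_head.
  by rewrite wedge_eq0r ?addr0 => [//|m _]; rewrite n2// mem_head.
by rewrite !IH ?addr0// => t vt; rewrite ?n1 ?n2 ?mulr0// inE vt orbT.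
Qed.

(** In a basis completing [v], a list of [k] basis vectors contains [v] or has
    a repetition. *)
Lemma top_form_annihilated k w v :
  \dim (fullv : {vspace V}) = k -> alternating w -> homogeneous k w ->
  v != 0 -> annihilates v w -> forall s, w s = 0.
Proof.
move=> dk aw hw v0 nv.
pose U := (<[v]>^C)%VS; pose e := vbasis U.
have dU : (\dim U).+1 = k.
  have := dimv_compl <[v]>; rewrite dim_vline v0 dk /U => ->.
  by rewrite subn1 prednK// -dk (leq_trans _ (dimvS (subvf <[v]>)))// dim_vline v0.
pose X (i : 'I_(\dim U).+1) := (v :: e)`_i.
apply: (multilinear_fun_spanned0 (X := X) aw.1) => [u|l].
  have : u \in (<[v]> + U)%VS by rewrite addv_complf memvf.
  move=> /memv_addP[_ /vlineP[a ->] [u' /coord_vbasis u'E ->]].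
  exists (fun i => oapp (fun j => coord e j u') a (unlift ord0 i)).
  rewrite big_ord_recl unlift_none/= [in LHS]u'E; congr (_ + _).
  by apply: eq_bigr => i _; rewrite liftK.
have [|vl] := boolP (ord0 \in l).
  by move=> /(map_f X); exact: nv.
have [sl|] := eqVneq (size (map X l)) k; last exact: hw.
apply: aw.2; apply/negP => /map_uniq ul.
have /card_uniqP ul0 : uniq (ord0 :: l) by rewrite /= vl ul.
by have := max_card (mem (ord0 :: l)); rewrite ul0 card_ord/= -(size_map X) sl -dU ltnn.
Qed.

End Alternating.

(** * Decomposable forms and the pairing *)

Section Covectors.
Context (R : realType) (V : vectType R).
Implicit Types (al : dual V) (w : seq V -> R) (s t : seq V) (u v : V).

(** The counterpart on a single fibre of [form_of_cosection]. *)
Definition oneform al s : R := if s is [:: v] then al v else 0.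

Definition onevector v (s : seq (dual V)) : R := if s is [:: al] then al v else 0.

Lemma alternating_oneform al : alternating (oneform al).
Proof.
split=> [s t c u v|[|x [|y s]]//].
case: s => [|x [|y s]]/=; rewrite ?mulr0 ?addr0//.
by case: t => [|y t]/=; rewrite ?linearP ?mulr0 ?addr0.
Qed.

Lemma alternating_onevector v : alternating (onevector v).
Proof.
split=> [s t c a b|[|x [|y s]]//].
case: s => [|x [|y s]]/=; rewrite ?mulr0 ?addr0//.
by case: t => [|y t]/=; rewrite ?add_lfunE ?scale_lfunE ?mulr0 ?addr0.
Qed.

Definition wedge_covectors (als : seq (dual V)) : seq V -> R :=
  foldr (fun al w => wedge (oneform al) w) (fun s => (nilp s)%:R) als.

Lemma alternating_wedge_covectors als : alternating (wedge_covectors als).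
Proof.
elim: als => [|al als IH]/=; first exact: alternating_nilp.
by apply: alternating_wedge => //; exact: alternating_oneform.
Qed.

Lemma wedge_covectors_homogeneous als : homogeneous (size als) (wedge_covectors als).
Proof.
elim: als => [|al als IH]/=; first by case.
by apply: (@wedge_homogeneous _ _ 1) => // -[|x [|y s]].
Qed.

Lemma wedge_covectors_eq0 als al s :
  al \in als -> (forall v, v \in s -> al v = 0) -> wedge_covectors als s = 0.
Proof.
elim: als s => //= be als IH s; rewrite inE => /predU1P[->|ials] al0.
  apply: wedge_eq0l => m _.
  case E : (mask m s) => [|x [|y t]]//=; apply: al0; apply: (@mem_mask _ _ m).
  by rewrite E mem_head.
by apply: wedge_eq0r => m _; apply: IH => // v /mem_mask; exact: al0.
Qed.

(** Only the term where the first covector receives the first vector survives. *)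
Lemma wedge_covectors_dual n (e : 'I_n -> V) (e' : 'I_n -> dual V) (J : seq 'I_n) :
  (forall i j, e' i (e j) = (i == j)%:R) -> uniq J ->
  wedge_covectors (map e' J) (map e J) = 1.
Proof.
move=> ee; elim: J => //= j J IH /andP[jJ uJ].
rewrite wedge_cons [X in _ + X]wedge_eq0l ?addr0 => [|m _]; last first.
  case E : (mask m (map e J)) => [|x [|y t]]/=; rewrite ?mulr0//.
  have : x \in map e J by apply: (@mem_mask _ _ m); rewrite E mem_head.
  move=> /mapP[i iJ ->]; rewrite ee; case: eqP => [ji|_]; last by rewrite mulr0.
  by rewrite ji iJ in jJ.
rewrite -[RHS](IH uJ) -[RHS]mul1r -wedge_scalarl; apply: eq_wedge => // t.
by case: t => [|x t]; rewrite /= ?ee ?eqxx ?mulr1 ?mulr0.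
Qed.

End Covectors.

Section Pairing.
Context (R : realType) (V : vectType R).
Local Notation N := (\dim (fullv : {vspace V})).
Implicit Types (P Q : seq (dual V) -> R) (w : seq V -> R).

(** The bases in terms of which [pairing] is defined. *)
Definition vb (i : 'I_N) : V := (vbasis (fullv : {vspace V}))`_i.

Definition vb_dual (i : 'I_N) : dual V :=
  linfun (fun v => coord (vbasis (fullv : {vspace V})) i v : R^o).

Lemma vb_dualE i v : vb_dual i v = coord (vbasis (fullv : {vspace V})) i v.
Proof. by rewrite lfunE. Qed.

Lemma vb_dual_vb i j : vb_dual i (vb j) = (i == j)%:R.
Proof.
have fr : free (vbasis (fullv : {vspace V})) by exact: basis_free (vbasisP _).
rewrite vb_dualE /vb.
by have := @coord_free _ _ _ (vbasis (fullv : {vspace V})) j i fr; rewrite eq_sym.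
Qed.

Lemma vb_expand v : v = \sum_i vb_dual i v *: vb i.
Proof.
have {1}-> := coord_vbasis (memvf v).
by apply: eq_bigr => i _; rewrite vb_dualE.
Qed.

Lemma vb_dual_expand (al : dual V) : al = \sum_i al (vb i) *: vb_dual i.
Proof.
apply/lfunP => v; rewrite sum_lfunE {1}(vb_expand v) linear_sum/=.
by apply: eq_bigr => i _; rewrite scale_lfunE linearZ; exact: mulrC.
Qed.

Lemma covector_sep u v : (forall be : dual V, be u = be v) -> u = v.
Proof.
by move=> uv; rewrite (vb_expand u) (vb_expand v); apply: eq_bigr => i _; rewrite uv.
Qed.

Lemma pairingE P w :
  pairing P w =
    \sum_(I : {set 'I_N}) P [seq vb_dual i | i <- enum I] * w [seq vb i | i <- enum I].
Proof. by []. Qed.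

Lemma pairing_wedge_vb_dual Q (J : {set 'I_N}) :
  pairing Q (wedge_covectors [seq vb_dual i | i <- enum J]) = Q [seq vb_dual i | i <- enum J].
Proof.
rewrite pairingE (bigD1 J)//= (wedge_covectors_dual vb_dual_vb) ?enum_uniq// mulr1.
rewrite big1 ?addr0// => I IJ.
have [sIJ|sIJ] := eqVneq #|I| #|J|; last first.
  by rewrite (wedge_covectors_homogeneous (als := map _ _)) ?mulr0// !size_map -!cardE.
have : ~~ (J \subset I).
  by apply: contraNN IJ => JI; rewrite eq_sym eqEcard JI sIJ leqnn.
move=> /subsetPn[j jJ jI].
rewrite (@wedge_covectors_eq0 _ _ _ (vb_dual j)) ?mulr0//.
  by apply: map_f; rewrite mem_enum.
move=> _ /mapP[i iI ->]; rewrite vb_dual_vb; case: eqP => // ji.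
by move: iI jI; rewrite mem_enum ji => ->.
Qed.

(** The exterior products of dual basis covectors single out the values that
    determine an alternating map. *)
Lemma pairing_inj Q Q' : alternating Q -> alternating Q' ->
  (forall als, pairing Q (wedge_covectors als) = pairing Q' (wedge_covectors als)) ->
  Q = Q'.
Proof.
move=> aQ aQ' E; apply/funext => s; apply/eqP; rewrite -subr_eq0; apply/eqP.
have a := alternating_comb (-1) aQ' aQ.
have sp al : exists c : 'I_N -> R, al = \sum_i c i *: vb_dual i.
  by exists (fun i => al (vb i)); exact: vb_dual_expand.
rewrite -mulN1r addrC; apply: (alternating_spanned0 a sp) => J.
by rewrite -!pairing_wedge_vb_dual E mulN1r addNr.
Qed.

Lemma pairing_onevector v w :
  pairing (onevector v) w = \sum_i vb_dual i v * w [:: vb i].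
Proof.
rewrite pairingE.
rewrite (bigID (fun I : {set 'I_N} => #|I| == 1%N))/= [X in _ + X]big1 ?addr0; last first.
  move=> I I1; rewrite /onevector; move: I1; rewrite cardE.
  by case: (enum I) => [|i [|j s]]//=; rewrite mul0r.
rewrite big_cards1; apply: eq_bigr => i _.
by rewrite enum_set1/=.
Qed.

Lemma pairing_onevector_multilinear v w :
  multilinear_fun w -> pairing (onevector v) w = w [:: v].
Proof.
move=> mw; rewrite pairing_onevector [in RHS](vb_expand v).
rewrite (multilinear_fun_sum [::] [::])//; apply: eq_bigr => i _.
by rewrite (multilinear_funZ [::] [::]).
Qed.

End Pairing.

(** * Local frames and smooth sections *)

(** For functions whose linearity is not registered as a structure. *)
Lemma linfunE (K : fieldType) (V W : vectType K) (f : V -> W) v :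
  linear f -> linfun f v = f v.
Proof.
move=> lf; pose F : {linear V -> W} := HB.pack f (GRing.isLinear.Build _ _ _ _ f lf).
exact: (lfunE F v).
Qed.

Section Frames.
Context (R : realType) (n : nat) (M : manifold R n) (r : nat) (A : vbundle M r).
Implicit Types (j k : triv_idx A) (x y : M) (U V : set M).

Lemma trivK j x : tdom j x -> cancel (triv j x) (triv j x)^-1%VF.
Proof. by move=> jx; apply/lker0_lfunK/lker0P/bij_inj; exact: triv_bij. Qed.

Lemma trivVK j x : tdom j x -> cancel (triv j x)^-1%VF (triv j x).
Proof.
move=> jx v; apply: limg_lfunVK.
have [g _ gK] := triv_bij jx; by rewrite -(gK v) memv_img// memvf.
Qed.

Lemma dim_fibre x : \dim (fullv : {vspace A x}) = r.
Proof.
have [j jx] := tdom_cover A x.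
have k0 : (fullv :&: lker (triv j x) = 0)%VS.
  have /eqP-> : lker (triv j x) == 0%VS by apply/lker0P/bij_inj; exact: triv_bij.
  exact: capv0.
rewrite -(limg_dim_eq k0).
have -> : limg (triv j x) = fullv.
  apply/vspaceP => v; rewrite memvf -(trivVK jx v).
  by rewrite memv_img// memvf.
by rewrite dimvf/= /dim/= mul1n.
Qed.

Lemma coframeE j x i v : coframe j x i v = triv j x v ord0 i.
Proof. by rewrite /coframe linfunE// => c u w; rewrite linearP !mxE. Qed.

Lemma coframe_frame j x i l : tdom j x -> coframe j x i (frame j x l) = (i == l)%:R.
Proof. by move=> jx; rewrite coframeE /frame trivVK// mxE eqxx. Qed.

Lemma frame_expand j x v : tdom j x -> v = \sum_i coframe j x i v *: frame j x i.
Proof.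
move=> jx; rewrite -[LHS](trivK jx) [triv j x v]row_sum_delta linear_sum/=.
by apply: eq_bigr => i _; rewrite linearZ/= coframeE.
Qed.

Lemma coframe_expand j x (al : dual (A x)) :
  tdom j x -> al = \sum_i al (frame j x i) *: coframe j x i.
Proof.
move=> jx; apply/lfunP => v; rewrite sum_lfunE {1}(frame_expand v jx) linear_sum/=.
by apply: eq_bigr => i _; rewrite scale_lfunE linearZ; exact: mulrC.
Qed.

Lemma smooth_coframe_frame j k i l :
  smooth_fun_on (tdom j `&` tdom k) (fun x => coframe k x i (frame j x l)).
Proof. by under eq_fun do rewrite coframeE; exact: triv_compat. Qed.

(** A change of trivialisation has smooth coefficients, so one trivialisation
    around each point suffices. *)
Lemma smooth_section_local (a : section A) :
  (forall x, exists j U, [/\ open U, U x, U `<=` tdom j &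
     forall i, smooth_fun_on U (fun y => coframe j y i (a y))]) ->
  smooth_section a.
Proof.
move=> H k i; apply: smooth_fun_on_local => x kx.
have [j [U [oU Ux Uj sa]]] := H x.
exists (U `&` tdom k) => //.
have oUk : open (U `&` tdom k) by apply: openI => //; exact: tdom_open.
apply: (@eq_smooth_fun_on _ _ _ _ _
    (fun y => \sum_l coframe j y l (a y) * coframe k y i (frame j y l))) => //.
  move=> y [/Uj jy ky]; rewrite -coframeE {1}(frame_expand (a y) jy) linear_sum.
  by apply: eq_bigr => l _; rewrite linearZ.
apply: smooth_fun_on_sum => // l _; apply: smooth_fun_onM => //.
  by apply: smooth_fun_onS (sa l) => y [].
by apply: (smooth_fun_onS _ (@smooth_coframe_frame j k i l)) => y [/Uj].
Qed.

Lemma smooth_cosection_local (al : cosection A) :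
  (forall x, exists j U, [/\ open U, U x, U `<=` tdom j &
     forall i, smooth_fun_on U (fun y => al y (frame j y i))]) ->
  smooth_cosection al.
Proof.
move=> H k i; apply: smooth_fun_on_local => x kx.
have [j [U [oU Ux Uj sa]]] := H x.
exists (U `&` tdom k) => //.
have oUk : open (U `&` tdom k) by apply: openI => //; exact: tdom_open.
apply: (@eq_smooth_fun_on _ _ _ _ _
    (fun y => \sum_l al y (frame j y l) * coframe j y l (frame k y i))) => //.
  move=> y [/Uj jy ky]; rewrite {1}(coframe_expand (al y) jy) sum_lfunE.
  by apply: eq_bigr => l _; rewrite scale_lfunE.
apply: smooth_fun_on_sum => // l _; apply: smooth_fun_onM => //.
  by apply: smooth_fun_onS (sa l) => y [].
by apply: (smooth_fun_onS _ (@smooth_coframe_frame k j l i)) => y [/Uj].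
Qed.

Lemma smooth_coframe (a : section A) j i :
  smooth_section a -> smooth_fun_on (tdom j) (fun y => coframe j y i (a y)).
Proof. by move=> sa; under eq_fun do rewrite coframeE; exact: sa. Qed.

Lemma smooth_sectionD (a b : section A) : smooth_section a -> smooth_section b ->
  smooth_section (fun y => a y + b y).
Proof.
move=> sa sb j i; have oj := @tdom_open _ _ _ _ A j.
apply: (eq_smooth_fun_on oj _ (smooth_fun_onD oj (sa j i) (sb j i))) => y _.
by rewrite linearD mxE.
Qed.

Lemma smooth_funS (f : M -> R) U : smooth_fun f -> smooth_fun_on U f.
Proof. by move=> sf; exact: smooth_fun_onS sf. Qed.

Lemma smooth_sectionZ (f : M -> R) (a : section A) : smooth_fun f -> smooth_section a ->
  smooth_section (fun y => f y *: a y).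
Proof.
move=> sf sa j i; have oj := @tdom_open _ _ _ _ A j.
apply: (eq_smooth_fun_on oj _ (smooth_fun_onM oj (smooth_funS sf) (sa j i))) => y _.
by rewrite linearZ mxE.
Qed.

Lemma smooth_fun_cst (c : R) : smooth_fun (fun _ : M => c).
Proof. exact/smooth_fun_on_cst/openT. Qed.

Lemma smooth_funD (f g : M -> R) :
  smooth_fun f -> smooth_fun g -> smooth_fun (fun x => f x + g x).
Proof. exact/smooth_fun_onD/openT. Qed.

Lemma smooth_funM (f g : M -> R) :
  smooth_fun f -> smooth_fun g -> smooth_fun (fun x => f x * g x).
Proof. exact/smooth_fun_onM/openT. Qed.

Lemma smooth_funN (f : M -> R) : smooth_fun f -> smooth_fun (fun x => - f x).
Proof. exact/smooth_fun_onN/openT. Qed.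

Lemma smooth_sectionN (a : section A) : smooth_section a -> smooth_section (fun y => - a y).
Proof.
move=> sa j i; have oj := @tdom_open _ _ _ _ A j.
by apply: (eq_smooth_fun_on oj _ (smooth_fun_onN oj (sa j i))) => y _; rewrite linearN mxE.
Qed.

Lemma smooth_section0 : smooth_section (fun y => 0 : A y).
Proof.
move=> j i; under eq_fun do rewrite linear0 mxE.
exact/smooth_fun_on_cst/tdom_open.
Qed.

Lemma smooth_section_sum (I : Type) (s : seq I) (a : I -> section A) :
  (forall i, smooth_section (a i)) -> smooth_section (fun y => \sum_(i <- s) a i y).
Proof.
move=> sa j l; have oj := @tdom_open _ _ _ _ A j.
apply: (@eq_smooth_fun_on _ _ _ _ _ (fun y => \sum_(i <- s) triv j y (a i y) ord0 l)) => //.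
  by move=> y _; rewrite linear_sum summxE.
by apply: smooth_fun_on_sum => // i _; exact: sa.
Qed.

Lemma smooth_cosection_eval (al : cosection A) (a : section A) :
  smooth_cosection al -> smooth_section a -> smooth_fun (fun y => al y (a y)).
Proof.
move=> sal sa; apply: smooth_fun_on_local => x _; have [j jx] := tdom_cover A x.
have oj := @tdom_open _ _ _ _ A j.
exists (tdom j) => //.
apply: (@eq_smooth_fun_on _ _ _ _ _
    (fun y => \sum_l al y (frame j y l) * coframe j y l (a y))) => //.
  move=> y jy; rewrite {1}(coframe_expand (al y) jy) sum_lfunE.
  by apply: eq_bigr => l _; rewrite scale_lfunE.
apply: smooth_fun_on_sum => // l _; apply: smooth_fun_onM => //.
exact: smooth_coframe.
Qed.

Lemma smooth_form_eval (w : diff_form A) (t : seq (section A)) :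
  smooth_form w -> (forall i, smooth_section (nth (fun=> 0) t i)) ->
  smooth_fun (eval_form w t).
Proof.
move=> [aw sw] st; apply: smooth_fun_on_local => x _; have [j jx] := tdom_cover A x.
have oj := @tdom_open _ _ _ _ A j.
exists (tdom j) => //; rewrite /eval_form.
suff : forall s : seq 'I_r, smooth_fun_on (tdom j)
    (fun y => w y (map (frame j y) s ++ [seq a y | a <- t])) by move=> /(_ [::]).
elim: t st => [|a t IH] st s; first by under eq_fun do rewrite cats0; exact: sw.
apply: (@eq_smooth_fun_on _ _ _ _ _ (fun y => \sum_l coframe j y l (a y) *
   w y (map (frame j y) (rcons s l) ++ [seq b y | b <- t]))) => //.
  move=> y jy /=; rewrite {1}(frame_expand (a y) jy) (multilinear_fun_sum _ _ _ _ (aw y).1).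
  apply: eq_bigr => l _; rewrite (multilinear_funZ _ _ _ _ (aw y).1).
  by rewrite map_rcons cat_rcons.
apply: smooth_fun_on_sum => // l _; apply: smooth_fun_onM => //.
  by apply: smooth_coframe; exact: (st 0%N).
by apply: IH => i; exact: (st i.+1).
Qed.

(** The families [E] are frames of the bundle or of its dual. *)
Lemma smooth_wedge_on U (I : Type) (T : M -> Type) (E : forall x, I -> T x)
    (W1 W2 : forall x, seq (T x) -> R) : open U ->
  (forall s, smooth_fun_on U (fun x => W1 x (map (E x) s))) ->
  (forall s, smooth_fun_on U (fun x => W2 x (map (E x) s))) ->
  forall s, smooth_fun_on U (fun x => wedge (W1 x) (W2 x) (map (E x) s)).
Proof.
move=> oU s1 s2 s; elim: s W1 W2 s1 s2 => [|i s IH] W1 W2 s1 s2.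
  apply: (eq_smooth_fun_on oU (fun x _ => wedge_nil (W1 x) (W2 x))).
  by apply: smooth_fun_onM => //; [exact: (s1 [::])|exact: (s2 [::])].
apply: (eq_smooth_fun_on oU (fun x _ => wedge_cons (W1 x) (W2 x) (E x i) (map (E x) s))).
apply: smooth_fun_onD => //.
  by apply: (IH (fun x t => W1 x (E x i :: t))) => // t; exact: (s1 (i :: t)).
apply: (IH (fun x t => (-1) ^+ size t * W1 x t) (fun x t => W2 x (E x i :: t))) => t.
  apply: (@eq_smooth_fun_on _ _ _ _ _ (fun x => (-1) ^+ size t * W1 x (map (E x) t))) => //.
    by move=> x _; rewrite size_map.
  by apply: smooth_fun_onM => //; exact: smooth_fun_on_cst.
exact: (s2 (i :: t)).
Qed.

Lemma smooth_multivector_wedge (P Q : multivector A) :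
  smooth_multivector P -> smooth_multivector Q ->
  smooth_multivector (fun x => wedge (P x) (Q x)).
Proof.
move=> [aP sP] [aQ sQ]; split=> [x|j s]; first exact: alternating_wedge.
apply: (@smooth_wedge_on _ _ _ (fun x => coframe j x)) => //; exact: tdom_open.
Qed.

Lemma smooth_multivector_comb (c : R) (P Q : multivector A) :
  smooth_multivector P -> smooth_multivector Q ->
  smooth_multivector (fun x s => c * P x s + Q x s).
Proof.
move=> [aP sP] [aQ sQ]; split=> [x|j s]; first exact: alternating_comb.
have oj := @tdom_open _ _ _ _ A j.
by apply: smooth_fun_onD => //; apply: smooth_fun_onM => //; exact: smooth_fun_on_cst.
Qed.

Lemma smooth_multivector0 : smooth_multivector (fun (x : M) (s : seq (dual (A x))) => 0 : R).
Proof.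
split=> [x|j s]; first by split=> [*|//]; rewrite mulr0 addr0.
exact/smooth_fun_on_cst/tdom_open.
Qed.

Lemma kvector_of_section (a : section A) :
  smooth_section a -> kvector 1 (multivector_of_section a).
Proof.
move=> sa; split; last by move=> x [|al [|be s]].
split=> [x|j [|i [|l s]]].
- exact: (alternating_onevector (a x)).
- exact/smooth_fun_on_cst/tdom_open.
- exact: smooth_coframe.
- exact/smooth_fun_on_cst/tdom_open.
Qed.

Lemma multivector_of_funE (f : M -> R) x s :
  multivector_of_fun A f x s = f x * (nilp s)%:R.
Proof. by case: s => [|? ?]; rewrite ?mulr1 ?mulr0. Qed.

Lemma kvector_of_fun (f : M -> R) :
  smooth_fun f -> kvector 0 (multivector_of_fun A f).
Proof.
move=> sf; split; last by move=> x [|al s].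
split=> [x|j [|i s]].
- have -> : multivector_of_fun A f x = (fun s => f x * (nilp s)%:R + 0).
    by apply/funext => s; rewrite multivector_of_funE addr0.
  apply: alternating_comb; first exact: alternating_nilp.
  by split=> [*|//]; rewrite mulr0 addr0.
- exact: smooth_funS.
- exact/smooth_fun_on_cst/tdom_open.
Qed.

Lemma smooth_form_wedge_covectors (als : seq (cosection A)) :
  (forall i, smooth_cosection (nth (fun=> 0) als i)) ->
  smooth_form (fun x => wedge_covectors [seq al x | al <- als]).
Proof.
move=> sal; split=> [x|j s]; first exact: alternating_wedge_covectors.
have oj := @tdom_open _ _ _ _ A j.
elim: als sal s => [|al als IH] sal s.
  by apply: (@eq_smooth_fun_on _ _ _ _ _ (fun=> (nilp s)%:R)) => // [y _|];
    [rewrite /= /nilp size_map|exact: smooth_fun_on_cst].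
apply: (@smooth_wedge_on _ _ _ (fun x => frame j x) (fun x => oneform (al x))) => //.
  case=> [|i [|l t]]; [exact: smooth_fun_on_cst| |exact: smooth_fun_on_cst].
  exact: (sal 0%N).
by apply: IH => i; exact: (sal i.+1).
Qed.

End Frames.

(** * Extension from a point and tensoriality *)

Section Extension.
Context (R : realType) (n : nat) (M : manifold R n) (r : nat) (A : vbundle M r).
Implicit Types (j : triv_idx A) (x y : M) (f g : M -> R) (K : set M).

Lemma sectionP (a b : section A) : (forall x, a x = b x) -> a = b.
Proof. exact: functional_extensionality_dep. Qed.

(** Off the closed set [K] the product vanishes on an open set. *)
Lemma smooth_fun_cutoff f g K j : smooth_fun f -> closed K -> K `<=` tdom j ->
  (forall y, ~ K y -> f y = 0) -> smooth_fun_on (tdom j) g ->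
  smooth_fun (fun y => f y * g y).
Proof.
move=> sf cK Kj f0 sg; apply: smooth_fun_on_local => y _.
have oj := @tdom_open _ _ _ _ A j.
have [/Kj jy|Ky] := pselect (K y).
  by exists (tdom j) => //; apply: smooth_fun_onM => //; exact: smooth_funS.
exists (~` K) => //; have oK : open (~` K) by exact: closed_openC.
apply: (@eq_smooth_fun_on _ _ _ _ _ (fun=> 0)) => //; last exact: smooth_fun_on_cst.
by move=> z /f0->; rewrite mul0r.
Qed.

Lemma smooth_section_cutoff f K j (b : section A) : smooth_fun f -> closed K ->
  K `<=` tdom j -> (forall y, ~ K y -> f y = 0) ->
  (forall i, smooth_fun_on (tdom j) (fun y => coframe j y i (b y))) ->
  smooth_section (fun y => f y *: b y).
Proof.
move=> sf cK Kj f0 sb; apply: smooth_section_local => y.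
have oj := @tdom_open _ _ _ _ A j.
have [/Kj jy|Ky] := pselect (K y).
  exists j, (tdom j); split=> // i.
  apply: (@eq_smooth_fun_on _ _ _ _ _ (fun y => f y * coframe j y i (b y))) => //.
    by move=> z _; rewrite linearZ.
  by apply: smooth_fun_onM => //; exact: smooth_funS.
have [k ky] := tdom_cover A y.
have oU : open (tdom k `&` ~` K) by apply: openI; [exact: tdom_open|exact: closed_openC].
exists k, (tdom k `&` ~` K); split=> // i.
apply: (@eq_smooth_fun_on _ _ _ _ _ (fun=> 0)) => //; last exact: smooth_fun_on_cst.
by move=> z [_ /f0->]; rewrite scale0r linear0.
Qed.

Lemma smooth_cosection_cutoff f K j (al : cosection A) : smooth_fun f -> closed K ->
  K `<=` tdom j -> (forall y, ~ K y -> f y = 0) ->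
  (forall i, smooth_fun_on (tdom j) (fun y => al y (frame j y i))) ->
  smooth_cosection (fun y => f y *: al y).
Proof.
move=> sf cK Kj f0 sal; apply: smooth_cosection_local => y.
have oj := @tdom_open _ _ _ _ A j.
have [/Kj jy|Ky] := pselect (K y).
  exists j, (tdom j); split=> // i.
  apply: (@eq_smooth_fun_on _ _ _ _ _ (fun y => f y * al y (frame j y i))) => //.
    by move=> z _; rewrite scale_lfunE.
  by apply: smooth_fun_onM => //; exact: smooth_funS.
have [k ky] := tdom_cover A y.
have oU : open (tdom k `&` ~` K) by apply: openI; [exact: tdom_open|exact: closed_openC].
exists k, (tdom k `&` ~` K); split=> // i.
apply: (@eq_smooth_fun_on _ _ _ _ _ (fun=> 0)) => //; last exact: smooth_fun_on_cst.
by move=> z [_ /f0->]; rewrite scale_lfunE scale0r.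
Qed.

Lemma smooth_frame_coef j i l :
  smooth_fun_on (tdom j) (fun y => coframe j y l (frame j y i)).
Proof.
apply: (@eq_smooth_fun_on _ _ _ _ _ (fun=> (l == i)%:R)); first exact: tdom_open.
  by move=> y jy; rewrite coframe_frame.
exact/smooth_fun_on_cst/tdom_open.
Qed.

Lemma section_through x (v : A x) : exists a : section A, smooth_section a /\ a x = v.
Proof.
have [j jx] := tdom_cover A x.
have [f [sf [V [_ Vx f1]] [K [cK Kj f0]]]] := bump_function (@tdom_open _ _ _ _ A j) jx.
exists (fun y => f y *: \sum_i coframe j x i v *: frame j y i); split; last first.
  by rewrite f1// scale1r [RHS](frame_expand v jx).
apply: (smooth_section_cutoff sf cK Kj f0) => i; have oj := @tdom_open _ _ _ _ A j.
apply: (@eq_smooth_fun_on _ _ _ _ _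
    (fun y => \sum_l coframe j x l v * coframe j y i (frame j y l))) => //.
  by move=> y _; rewrite linear_sum; apply: eq_bigr => l _; rewrite linearZ.
apply: smooth_fun_on_sum => // l _; apply: smooth_fun_onM => //.
  exact: smooth_fun_on_cst.
exact: smooth_frame_coef.
Qed.

Lemma extendP x (v : A x) : smooth_section (extend v) /\ extend v x = v.
Proof.
rewrite /extend; case: pselect => [h|]; first exact: (projT2 (cid h)).
by move=> H; exfalso; apply: H; exact: section_through.
Qed.

Lemma smooth_extend x (v : A x) : smooth_section (extend v).
Proof. exact: (extendP v).1. Qed.

Lemma extendE x (v : A x) : extend v x = v.
Proof. exact: (extendP v).2. Qed.

Lemma cosection_through x (al : dual (A x)) :
  exists be : cosection A, smooth_cosection be /\ be x = al.
Proof.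
have [j jx] := tdom_cover A x.
have [f [sf [V [_ Vx f1]] [K [cK Kj f0]]]] := bump_function (@tdom_open _ _ _ _ A j) jx.
exists (fun y => f y *: \sum_i al (frame j x i) *: coframe j y i); split; last first.
  by rewrite f1// scale1r [RHS](coframe_expand al jx).
apply: (smooth_cosection_cutoff sf cK Kj f0) => i; have oj := @tdom_open _ _ _ _ A j.
apply: (@eq_smooth_fun_on _ _ _ _ _
    (fun y => \sum_l al (frame j x l) * coframe j y l (frame j y i))) => //.
  by move=> y _; rewrite sum_lfunE; apply: eq_bigr => l _; rewrite scale_lfunE.
apply: smooth_fun_on_sum => // l _; apply: smooth_fun_onM => //.
  exact: smooth_fun_on_cst.
exact: smooth_frame_coef.
Qed.

(** With [f] a bump function at [x] and [e_i] a frame, a section [c] vanishing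
    at [x] is [(1 - f^2) c + \sum_i (f c_i) (f e_i)], a combination of global
    sections with coefficients vanishing at [x]. *)
Lemma tensorial_local x (F : section A -> R) :
  (forall a b, smooth_section a -> smooth_section b ->
     F (fun y => a y + b y) = F a + F b) ->
  (forall f a, smooth_fun f -> smooth_section a -> F (fun y => f y *: a y) = f x * F a) ->
  forall a b, smooth_section a -> smooth_section b -> a x = b x -> F a = F b.
Proof.
move=> FD FZ a b sa sb ab.
pose c : section A := fun y => a y + (-1) *: b y.
have sc : smooth_section c.
  apply: smooth_sectionD => //; apply: (@smooth_sectionZ _ _ _ _ _ (fun=> -1)) => //.
  exact: smooth_fun_cst.
have cx : c x = 0 by rewrite /c ab scaleN1r subrr.
suff Fc : F c = 0.
  move: Fc; rewrite /c FD//; last first.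
    apply: (@smooth_sectionZ _ _ _ _ _ (fun=> -1)) => //; exact: smooth_fun_cst.
  rewrite (FZ (fun=> -1))//; last exact: smooth_fun_cst.
  by rewrite mulN1r => /eqP; rewrite subr_eq0 => /eqP.
have [j jx] := tdom_cover A x.
have [f [sf [V [_ Vx f1]] [K [cK Kj f0]]]] := bump_function (@tdom_open _ _ _ _ A j) jx.
pose p i y := f y * coframe j y i (c y).
pose e i : section A := fun y => f y *: frame j y i.
have sp i : smooth_fun (p i).
  by apply: (smooth_fun_cutoff sf cK Kj f0); exact: smooth_coframe.
have se i : smooth_section (e i).
  by apply: (smooth_section_cutoff sf cK Kj f0) => l; exact: smooth_frame_coef.
have spe i : smooth_section (fun y => p i y *: e i y) by exact: smooth_sectionZ.
have sg : smooth_fun (fun y => 1 + - (f y * f y)).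
  apply: smooth_funD; first exact: smooth_fun_cst.
  by apply: smooth_funN; exact: smooth_funM.
have -> : c = (fun y => (1 + - (f y * f y)) *: c y + \sum_i p i y *: e i y).
  apply: sectionP => y; have [Ky|/f0 fy] := pselect (K y); last first.
    rewrite /p /e fy mul0r oppr0 addr0 scale1r big1 ?addr0// => i _.
    by rewrite mul0r scale0r.
  rewrite scalerDl scale1r scaleNr -addrA [X in c y + X](_ : _ = 0) ?addr0//.
  rewrite {1}(frame_expand (c y) (Kj _ Ky)) scaler_sumr addrC; apply/eqP.
  rewrite subr_eq0; apply/eqP; apply: eq_bigr => i _.
  by rewrite /p /e !scalerA; congr (_ *: _); ring.
rewrite FD; [|exact: smooth_sectionZ|by apply: smooth_section_sum => i; exact: spe].
rewrite (FZ (fun y => 1 + - (f y * f y)))// f1// mulr1 subrr mul0r add0r.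
have F0 : F (fun=> 0) = 0.
  have := FZ (fun=> 0) c (@smooth_fun_cst _ _ M 0) sc; rewrite mul0r => <-.
  by congr (F _); apply: sectionP => y; rewrite scale0r.
have FS (s : seq 'I_r) :
    F (fun y => \sum_(i <- s) p i y *: e i y) = \sum_(i <- s) p i x * F (e i).
  elim: s => [|i s IH].
    by rewrite big_nil -[RHS]F0; congr (F _); apply: sectionP => y; rewrite big_nil.
  rewrite big_cons -IH -FZ// -FD//; last exact: smooth_section_sum.
  by congr (F _); apply: sectionP => y; rewrite big_cons.
by rewrite FS big1// => i _; rewrite /p cx linear0 mulr0 mul0r.
Qed.

End Extension.

(** * Locality of derivations *)

Section Derivation.
Context (R : realType) (n : nat) (M : manifold R n) (x : M) (D : tangent x).
Implicit Types (f g : M -> R).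

Lemma tangentD f g : smooth_fun f -> smooth_fun g ->
  D (fun y => f y + g y) = D f + D g.
Proof.
move=> sf sg; rewrite -[X in X + _]mul1r -(tderiv_linear D 1 sf sg).
by congr (D _); apply/funext => y; rewrite mul1r.
Qed.

Lemma tangentM f g : smooth_fun f -> smooth_fun g ->
  D (fun y => f y * g y) = f x * D g + g x * D f.
Proof. exact: tderiv_leibniz. Qed.

Lemma tangent_cst c : D (fun=> c) = 0.
Proof.
have s1 := @smooth_fun_cst _ _ M 1.
have D1 : D (fun=> 1) = 0.
  have := tangentM s1 s1; rewrite !mul1r => H.
  have : D (fun=> 1) = D (fun=> 1) + D (fun=> 1).
    by rewrite -H; congr (D _); apply/funext => y; rewrite mulr1.
  by move=> /eqP; rewrite -subr_eq0 opprD addrA subrr sub0r oppr_eq0 => /eqP.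
have s0 := @smooth_fun_cst _ _ M 0.
have D0 : D (fun=> 0) = 0.
  have E : (fun _ : M => -1 * (0 : R) + 0) = (fun=> 0) by apply/funext => y; ring.
  by have := tderiv_linear D (-1) s0 s0; rewrite E; lra.
have E : (fun _ : M => c * 1 + 0) = (fun=> c) by apply/funext => y; ring.
by have := tderiv_linear D c s1 s0; rewrite E D1 D0; lra.
Qed.

Lemma tangentZ c f : smooth_fun f -> D (fun y => c * f y) = c * D f.
Proof.
move=> sf; rewrite tangentM// ?tangent_cst ?mulr0 ?addr0//; exact: smooth_fun_cst.
Qed.

Lemma tangent_sum (I : Type) (s : seq I) (f : I -> M -> R) :
  (forall i, smooth_fun (f i)) ->
  D (fun y => \sum_(i <- s) f i y) = \sum_(i <- s) D (f i).
Proof.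
move=> sf; elim: s => [|i s IH].
  rewrite big_nil -[RHS](tangent_cst 0); congr (D _); apply/funext => y.
  by rewrite big_nil.
rewrite big_cons -IH -tangentD//.
  by congr (D _); apply/funext => y; rewrite big_cons.
by apply: smooth_fun_on_sum; [exact: openT|move=> l _; exact: sf].
Qed.

End Derivation.

(** A function [h] equal to [1] near [x] is one whose defect [1 - h] is absorbed
    by a function vanishing at [x]; derivations of any kind kill such an [h]. *)
Lemma near_one_absorb (R : realType) (n : nat) (M : manifold R n) (x : M)
    (V : set M) (h : M -> R) :
  open V -> V x -> (forall y, V y -> h y = 1) ->
  exists k : M -> R, [/\ smooth_fun k, k x = 0 & forall y, (1 - h y) * k y = 1 - h y].
Proof.
move=> oV Vx h1.
have [f [sf [V' [_ V'x f1]] [K [cK KV f0]]]] := bump_function oV Vx.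
exists (fun y => 1 + - f y); split.
- by apply: smooth_funD; [exact: smooth_fun_cst|exact: smooth_funN].
- by rewrite f1// subrr.
- move=> y; have [/KV/h1->|/f0->] := pselect (K y); first by rewrite subrr mul0r.
  by rewrite subr0 mulr1.
Qed.

Lemma tangent_near_one (R : realType) (n : nat) (M : manifold R n) (x : M)
    (D : tangent x) (V : set M) (h : M -> R) :
  smooth_fun h -> open V -> V x -> (forall y, V y -> h y = 1) -> D h = 0.
Proof.
move=> sh oV Vx h1; have [k [sk kx kE]] := near_one_absorb oV Vx h1.
have sg : smooth_fun (fun y => 1 + - h y).
  by apply: smooth_funD; [exact: smooth_fun_cst|exact: smooth_funN].
have Dg : D (fun y => 1 + - h y) = 0.
  have := tangentM D sg sk; rewrite kx mul0r addr0 h1// subrr mul0r => <-.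
  by congr (D _); apply/funext => y; rewrite kE.
have := tangentD D sg sh; rewrite Dg add0r => <-; rewrite -[RHS](tangent_cst D 1).
by congr (D _); apply/funext => y; rewrite addrNK.
Qed.

(** * The anchor, the bracket and the Lie derivative *)

Section LieAlgebroid.
Context (R : realType) (n : nat) (M : manifold R n) (r : nat) (A : vbundle M r)
        (L : lie_algebroid A).
Implicit Types (a b c : section A) (f g : M -> R) (x y : M).
Local Notation br := (bracket L).

Lemma actD a f g x : smooth_fun f -> smooth_fun g ->
  act L a (fun y => f y + g y) x = act L a f x + act L a g x.
Proof. exact: tangentD. Qed.

Lemma actM a f g x : smooth_fun f -> smooth_fun g ->
  act L a (fun y => f y * g y) x = f x * act L a g x + g x * act L a f x.
Proof. exact: tangentM. Qed.

Lemma actZ a k f x : smooth_fun f -> act L a (fun y => k * f y) x = k * act L a f x.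
Proof. exact: tangentZ. Qed.

Lemma act_cst a k x : act L a (fun=> k) x = 0.
Proof. exact: tangent_cst. Qed.

Lemma act_sum a (I : Type) (s : seq I) (f : I -> M -> R) x :
  (forall i, smooth_fun (f i)) ->
  act L a (fun y => \sum_(i <- s) f i y) x = \sum_(i <- s) act L a (f i) x.
Proof. exact: tangent_sum. Qed.

Lemma anchorD x (u v : A x) f : smooth_fun f ->
  anchor L (u + v) f = anchor L u f + anchor L v f.
Proof. by move=> sf; rewrite -[u]scale1r anchor_linear// mul1r scale1r. Qed.

Lemma anchor0 x f : smooth_fun f -> anchor L (0 : A x) f = 0.
Proof.
move=> sf; have := anchorD (0 : A x) 0 sf; rewrite addr0 => /eqP.
by rewrite -subr_eq0 opprD addrA subrr sub0r oppr_eq0 => /eqP.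
Qed.

Lemma anchorZ x k (u : A x) f : smooth_fun f -> anchor L (k *: u) f = k * anchor L u f.
Proof. by move=> sf; have := anchor_linear L k u 0 sf; rewrite anchor0// !addr0. Qed.

Lemma anchor_sum x (I : Type) (s : seq I) (u : I -> A x) f : smooth_fun f ->
  anchor L (\sum_(i <- s) u i) f = \sum_(i <- s) anchor L (u i) f.
Proof.
move=> sf; elim: s => [|i s IH]; first by rewrite !big_nil anchor0.
by rewrite !big_cons anchorD// IH.
Qed.

Lemma eq_bracket a a' b b' x : (forall y, a y = a' y) -> (forall y, b y = b' y) ->
  br a b x = br a' b' x.
Proof. by move=> /sectionP-> /sectionP->. Qed.

Lemma bracketDl a b c x : smooth_section a -> smooth_section b -> smooth_section c ->
  br (fun y => a y + b y) c x = br a c x + br b c x.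
Proof.
move=> sa sb sc; rewrite -[X in X + _]scale1r -bracket_linear//.
by apply: eq_bracket => // y; rewrite scale1r.
Qed.

Lemma bracketDr a b c x : smooth_section a -> smooth_section b -> smooth_section c ->
  br c (fun y => a y + b y) x = br c a x + br c b x.
Proof.
move=> sa sb sc; rewrite bracket_skew ?bracketDl//; last exact: smooth_sectionD.
by rewrite opprD -!bracket_skew.
Qed.

Lemma bracketZr f a b x : smooth_fun f -> smooth_section a -> smooth_section b ->
  br a (fun y => f y *: b y) x = f x *: br a b x + act L a f x *: b x.
Proof. by move=> *; exact: bracket_leibniz. Qed.

Lemma bracketZl f a b x : smooth_fun f -> smooth_section a -> smooth_section b ->
  br (fun y => f y *: a y) b x = f x *: br a b x - act L b f x *: a x.
Proof.
move=> sf sa sb; rewrite bracket_skew ?bracketZr//; last exact: smooth_sectionZ.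
by rewrite opprD -scalerN -bracket_skew.
Qed.

Lemma bracket0r a x : smooth_section a -> br a (fun=> 0) x = 0.
Proof.
move=> sa; have s0 := @smooth_section0 _ _ _ _ A.
have := bracketZr x (@smooth_fun_cst _ _ M 0) sa s0.
rewrite act_cst !scale0r addr0 => <-.
by apply: eq_bracket => // y; rewrite scaler0.
Qed.

Lemma bracket0l a x : smooth_section a -> br (fun=> 0) a x = 0.
Proof.
by move=> sa; rewrite bracket_skew ?bracket0r ?oppr0//; exact: smooth_section0.
Qed.

Lemma bracketNr a b x : smooth_section a -> smooth_section b ->
  br a (fun y => - b y) x = - br a b x.
Proof.
move=> sa sb; have := bracketZr x (@smooth_fun_cst _ _ M (-1)) sa sb.
rewrite act_cst scale0r addr0 scaleN1r => <-.
by apply: eq_bracket => // y; rewrite scaleN1r.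
Qed.

Lemma bracket_sumr c (I : Type) (s : seq I) (a : I -> section A) x :
  smooth_section c -> (forall i, smooth_section (a i)) ->
  br c (fun y => \sum_(i <- s) a i y) x = \sum_(i <- s) br c (a i) x.
Proof.
move=> sc sa; elim: s => [|i s IH].
  rewrite big_nil -[RHS](bracket0r x sc).
  by apply: eq_bracket => // y; rewrite big_nil.
rewrite big_cons -IH -bracketDr//; last exact: smooth_section_sum.
by apply: eq_bracket => // y; rewrite big_cons.
Qed.

Lemma tensorial_sum x (F : section A -> R) (I : Type) (s : seq I) (k : I -> R)
    (a : I -> section A) :
  (forall a b, smooth_section a -> smooth_section b ->
     F (fun y => a y + b y) = F a + F b) ->
  (forall f a, smooth_fun f -> smooth_section a -> F (fun y => f y *: a y) = f x * F a) ->
  (forall i, smooth_section (a i)) ->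
  F (fun y => \sum_(i <- s) k i *: a i y) = \sum_(i <- s) k i * F (a i).
Proof.
move=> FD FZ sa; have FZc (k0 : R) b : smooth_section b -> F (fun y => k0 *: b y) = k0 * F b.
    by apply: (FZ (fun=> k0)); exact: smooth_fun_cst.
have ska i : smooth_section (fun y => k i *: a i y).
  by apply: (@smooth_sectionZ _ _ _ _ _ (fun=> k i)) => //; exact: smooth_fun_cst.
elim: s => [|i s IH].
  rewrite big_nil -[RHS](mul0r (F (fun=> 0))) -FZc; last exact: smooth_section0.
  by congr (F _); apply: sectionP => y; rewrite big_nil scale0r.
rewrite big_cons -IH -FZc// -FD//; last exact: smooth_section_sum.
by congr (F _); apply: sectionP => y; rewrite big_cons.
Qed.

(** This relates a tensorial map to the basis used in the pairing. *)
Lemma tensorial_expand x (F : section A -> R) b :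
  (forall a b, smooth_section a -> smooth_section b ->
     F (fun y => a y + b y) = F a + F b) ->
  (forall f a, smooth_fun f -> smooth_section a -> F (fun y => f y *: a y) = f x * F a) ->
  smooth_section b ->
  F b = \sum_i vb_dual i (b x) * F (extend (vb i)).
Proof.
move=> FD FZ sb; rewrite -(tensorial_sum _ _ FD FZ); last by move=> i; exact: smooth_extend.
apply: (tensorial_local FD FZ) => //.
  apply: smooth_section_sum => i.
  by apply: (@smooth_sectionZ _ _ _ _ _ (fun=> _)); [exact: smooth_fun_cst|exact: smooth_extend].
by rewrite [LHS]vb_expand; apply: eq_bigr => i _; rewrite extendE.
Qed.

(** Covectors at a point extend to global cosections, so the decomposable forms
    that separate multivectors at that point are values of global forms. *)
Lemma is_lie_multivector_unique a P Q Q' :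
  is_lie_multivector L a P Q -> is_lie_multivector L a P Q' -> Q = Q'.
Proof.
move=> [[aQ _] HQ] [[aQ' _] HQ']; apply: functional_extensionality_dep => x.
apply: pairing_inj => // als.
pose ext (al : dual (A x)) := projT1 (cid (cosection_through al)).
have extP al : smooth_cosection (ext al) /\ ext al x = al.
  exact: (projT2 (cid (cosection_through al))).
pose w : diff_form A := fun y => wedge_covectors [seq be y | be <- map ext als].
have sw : smooth_form w.
  apply: smooth_form_wedge_covectors => i.
  have [il|il] := ltnP i (size als); last first.
    rewrite nth_default ?size_map// => j l.
    apply: (@eq_smooth_fun_on _ _ _ _ _ (fun=> 0)); first exact: tdom_open.
      by move=> y _; rewrite zero_lfunE.
    exact/smooth_fun_on_cst/tdom_open.
  rewrite (nth_map 0)//; exact: (extP _).1.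
have <- : w x = wedge_covectors als.
  rewrite /w -map_comp; congr wedge_covectors; rewrite -[RHS]map_id.
  by apply: eq_map => al /=; exact: (extP al).2.
by rewrite HQ// HQ'.
Qed.

(** In degree one the defining identity of the Lie derivative is the product
    rule for [w b]; the Lie derivative of [w] is tensorial, hence computed by
    [b] itself rather than by extensions of basis vectors. *)
Lemma lie_multivector_section a b : smooth_section a -> smooth_section b ->
  is_lie_multivector L a (multivector_of_section b) (multivector_of_section (br a b)).
Proof.
move=> sa sb; split; first by case: (kvector_of_section (bracket_smooth L sa sb)).
move=> w sw x; have [aw _] := sw.
have pE y c : pairing (multivector_of_section c y) (w y) = eval_form w [:: c] y.
  rewrite -[multivector_of_section c y]/(onevector (c y)).
  by rewrite (pairing_onevector_multilinear _ (aw y).1).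
rewrite (_ : (fun y => pairing _ _) = eval_form w [:: b]); last exact/funext.
rewrite pE -[multivector_of_section b x]/(onevector (b x)) pairing_onevector.
pose G c := act L a (eval_form w [:: c]) x - w x [:: br a c x].
have sev c : smooth_section c -> smooth_fun (eval_form w [:: c]).
  move=> sc; apply: smooth_form_eval => // -[|i]//=; rewrite nth_nil; exact: smooth_section0.
have GD c d : smooth_section c -> smooth_section d -> G (fun y => c y + d y) = G c + G d.
  move=> sc sd; rewrite /G bracketDr// (multilinear_funD [::] _ _ _ (aw x).1)/=.
  rewrite (_ : eval_form w [:: (fun y => c y + d y)] =
      (fun y => eval_form w [:: c] y + eval_form w [:: d] y)); last first.
    by apply/funext => y; rewrite /eval_form/= (multilinear_funD [::] _ _ _ (aw y).1).
  rewrite actD; [ring|exact: sev|exact: sev].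
have GZ f c : smooth_fun f -> smooth_section c -> G (fun y => f y *: c y) = f x * G c.
  move=> sf sc; rewrite /G bracketZr// (multilinear_funD [::] _ _ _ (aw x).1)/=.
  rewrite !(multilinear_funZ [::] _ _ _ (aw x).1)/=.
  rewrite (_ : eval_form w [:: (fun y => f y *: c y)] =
      (fun y => f y * eval_form w [:: c] y)); last first.
    by apply/funext => y; rewrite /eval_form/= (multilinear_funZ [::] _ _ _ (aw y).1).
  rewrite actM//; last exact: sev.
  by rewrite /eval_form/=; ring.
rewrite (_ : \sum_i _ = G b); first by rewrite /G /eval_form/=; ring.
rewrite (tensorial_expand GD GZ sb); apply: eq_bigr => i _.
by rewrite /lie_form /tensor_at/= big_ord1.
Qed.

End LieAlgebroid.

(** * Locality of the Schouten bracket *)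

Section Schouten.
Context (R : realType) (n : nat) (M : manifold R n) (r : nat) (A : vbundle M r)
        (L : lie_algebroid A) (B : multivector A -> multivector A -> multivector A)
        (HB : is_schouten L B).
Arguments B : clear implicits.
Implicit Types (a b c : section A) (f g h : M -> R) (x y : M) (P Q S : multivector A).
Local Notation br := (bracket L).
Local Notation mv := multivector_of_section.

Lemma multivectorP P Q : (forall x s, P x s = Q x s) -> P = Q.
Proof. by move=> PQ; apply: functional_extensionality_dep => x; exact/funext. Qed.

Lemma schouten_sections a b : smooth_section a -> smooth_section b ->
  B (mv a) (mv b) = mv (br a b).
Proof.
move=> sa sb; apply: (@is_lie_multivector_unique _ _ _ _ _ L a (mv b)).
  by apply: schouten_section => //; case: (kvector_of_section sb).
exact: lie_multivector_section.
Qed.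

Lemma is_lie_multivectorE a P Q : smooth_section a -> smooth_multivector P ->
  is_lie_multivector L a P Q <-> B (mv a) P = Q.
Proof.
move=> sa sP; split=> [H|<-]; last exact: schouten_section.
by apply: (is_lie_multivector_unique _ H); exact: schouten_section.
Qed.

Lemma schouten0r P : smooth_multivector P -> B P (fun _ _ => 0) = (fun _ _ => 0).
Proof.
move=> sP; have s0 := @smooth_multivector0 _ _ _ _ A.
have := schouten_linearr HB (-1) sP s0 s0.
have -> : (fun (x : M) (s : seq (dual (A x))) => -1 * 0 + 0 : R) = (fun _ _ => 0).
  by apply: multivectorP => x s; rewrite mulr0 addr0.
by move=> ->; apply: multivectorP => x s; rewrite mulN1r addNr.
Qed.

Lemma smooth_multivector_sum (I : Type) (t : seq I) (Q : I -> multivector A) :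
  (forall i, smooth_multivector (Q i)) ->
  smooth_multivector (fun x s => \sum_(i <- t) Q i x s).
Proof.
move=> sQ; elim: t => [|i t IH].
  rewrite (_ : (fun x s => _) = (fun _ _ => 0)); first exact: smooth_multivector0.
  by apply: multivectorP => x s; rewrite big_nil.
rewrite (_ : (fun x s => _) = (fun x s => 1 * Q i x s + \sum_(i <- t) Q i x s)).
  exact: smooth_multivector_comb.
by apply: multivectorP => x s; rewrite big_cons mul1r.
Qed.

Lemma schouten_sumr P (I : Type) (t : seq I) k (Q : I -> multivector A) :
  smooth_multivector P -> (forall i, smooth_multivector (Q i)) ->
  B P (fun x s => \sum_(i <- t) k * Q i x s) = (fun x s => \sum_(i <- t) k * B P (Q i) x s).
Proof.
move=> sP sQ; elim: t => [|i t IH].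
  rewrite (_ : (fun x s => _) = (fun _ _ => 0)).
    by rewrite schouten0r//; apply: multivectorP => x s; rewrite big_nil.
  by apply: multivectorP => x s; rewrite big_nil.
rewrite (_ : (fun x s => _) = (fun x s => k * Q i x s + \sum_(i <- t) k * Q i x s)); last first.
  by apply: multivectorP => x s; rewrite big_cons.
rewrite (schouten_linearr HB)// ?IH; last first.
  have -> : (fun x s => \sum_(i <- t) k * Q i x s) = (fun x s => \sum_(i <- t) (k * Q i x s + 0)).
    by apply: multivectorP => x s; apply: eq_bigr => j _; rewrite addr0.
  apply: (@smooth_multivector_sum _ t (fun i x s => k * Q i x s + 0)) => j.
  by apply: smooth_multivector_comb => //; exact: smooth_multivector0.
by apply: multivectorP => x s; rewrite big_cons.
Qed.

Lemma wedge_multivector_of_fun f x P s :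
  wedge (multivector_of_fun A f x) (P x) s = f x * P x s.
Proof.
rewrite -wedge_scalarl; apply: eq_wedge => // t; exact: multivector_of_funE.
Qed.

Lemma schouten_scale k P f Q x s : kvector k P -> smooth_fun f -> smooth_multivector Q ->
  B P (fun x s => f x * Q x s) x s =
  wedge (B P (multivector_of_fun A f) x) (Q x) s + f x * B P Q x s.
Proof.
move=> kP sf sQ.
rewrite (_ : (fun x s => _) =
    (fun x => wedge (multivector_of_fun A f x) (Q x))); last first.
  by apply: multivectorP => y t; rewrite wedge_multivector_of_fun.
rewrite (schouten_leibniz HB kP (kvector_of_fun A sf) sQ).
by rewrite muln0 expr0 mul1r wedge_multivector_of_fun.
Qed.

Lemma schouten_funM k P f g x s : kvector k P -> smooth_fun f -> smooth_fun g ->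
  B P (multivector_of_fun A (fun y => f y * g y)) x s =
  g x * B P (multivector_of_fun A f) x s + f x * B P (multivector_of_fun A g) x s.
Proof.
move=> kP sf sg.
have -> : multivector_of_fun A (fun y => f y * g y) =
    (fun x s => f x * multivector_of_fun A g x s).
  by apply: multivectorP => y t; rewrite !multivector_of_funE mulrA.
rewrite (schouten_scale _ kP)//; last by case: (kvector_of_fun A sg).
congr (_ + _); rewrite -wedge_scalarr; apply: eq_wedge => // t.
exact: multivector_of_funE.
Qed.

(** The bracket with [P] is a derivation on functions, which kills constants;
    this makes the Schouten bracket a local operation. *)
Lemma schouten_near_one k P h V x s : kvector k P -> smooth_fun h -> open V -> V x ->
  (forall y, V y -> h y = 1) -> B P (multivector_of_fun A h) x s = 0.
Proof.
move=> kP sh oV Vx h1; have [g [sg gx gE]] := near_one_absorb oV Vx h1.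
have sP := kP.1; have s1 := @smooth_fun_cst _ _ M 1.
have B1 : B P (multivector_of_fun A (fun=> 1)) x s = 0.
  have := schouten_funM s kP s1 s1; rewrite !mul1r.
  by move=> /eqP; rewrite -subr_eq0 opprD addrA subrr sub0r oppr_eq0 => /eqP.
have sd : smooth_fun (fun y => 1 + - h y) by apply: smooth_funD => //; exact: smooth_funN.
have : B P (multivector_of_fun A (fun y => (1 + - h y) * g y)) x s = 0.
  by rewrite (schouten_funM _ kP)// gx h1// subrr !mul0r addr0.
rewrite (_ : multivector_of_fun A _ =
   (fun y t => -1 * multivector_of_fun A h y t + multivector_of_fun A (fun=> 1) y t)); last first.
  apply: multivectorP => y t; rewrite !multivector_of_funE gE; ring.
have smf f : smooth_fun f -> smooth_multivector (multivector_of_fun A f).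
  by move=> sf; case: (kvector_of_fun A sf).
rewrite (schouten_linearr HB)//; [|exact: smf|exact: smf].
by rewrite B1 addr0 mulN1r => /eqP; rewrite oppr_eq0 => /eqP.
Qed.

Lemma schouten_localr k P h V Q x s : kvector k P -> smooth_fun h -> open V -> V x ->
  (forall y, V y -> h y = 1) -> smooth_multivector Q ->
  B P Q x s = B P (fun x s => h x * Q x s) x s.
Proof.
move=> kP sh oV Vx h1 sQ; rewrite (schouten_scale _ kP)// h1// mul1r.
rewrite wedge_eq0l ?add0r// => m _.
exact: (schouten_near_one _ kP sh oV Vx h1).
Qed.

(** Multiplying by [h] turns the local expression of [Q] as a sum of exterior
    products into one by global sections, to which the Leibniz rule of the
    Schouten bracket applies. *)
Record decomposition (Q : multivector A) (x : M) (h : M -> R)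
    (a b : 'I_r -> section A) : Prop := Decomposition {
  decomp_fun : smooth_fun h;
  decomp_nbhd : exists V, [/\ open V, V x & forall y, V y -> h y = 1];
  decomp_left : forall i, smooth_section (a i);
  decomp_right : forall i, smooth_section (b i);
  decomp_eq : forall y s,
    h y * Q y s = \sum_i 2^-1 * wedge (mv (a i) y) (mv (b i) y) s }.

Lemma wedge_sections a b x al be :
  wedge (mv a x) (mv b x) [:: al; be] = al (a x) * be (b x) - be (a x) * al (b x).
Proof.
rewrite !wedge_cons !wedge_nil/= /multivector_of_section/=; ring.
Qed.

(** In a frame [e_i] with dual coframe [e'_i], and [f] a bump function, take
    [a_i = f e_i] and [b_i = f Q(e'_i, .)]. *)
Lemma decomposition_exists (Q : multivector A) x : kvector 2 Q ->
  exists h (a b : 'I_r -> section A), decomposition Q x h a b.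
Proof.
move=> [[aQ sQ] hQ].
have [j jx] := tdom_cover A x; have oj := @tdom_open _ _ _ _ A j.
have [f [sf [V [oV Vx f1]] [K [cK Kj f0]]]] := bump_function oj jx.
exists (fun y => f y * f y), (fun i y => f y *: frame j y i),
  (fun i y => f y *: \sum_k Q y [:: coframe j y i; coframe j y k] *: frame j y k).
split.
- exact: smooth_funM.
- by exists V; split=> // y /f1->; rewrite mulr1.
- by move=> i; apply: (smooth_section_cutoff sf cK Kj f0) => l; exact: smooth_frame_coef.
- move=> i; apply: (smooth_section_cutoff sf cK Kj f0) => l.
  apply: (@eq_smooth_fun_on _ _ _ _ _ (fun y => \sum_k
      Q y [:: coframe j y i; coframe j y k] * coframe j y l (frame j y k))) => //.
    by move=> y _; rewrite linear_sum; apply: eq_bigr => k _; rewrite linearZ.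
  apply: smooth_fun_on_sum => // k _; apply: smooth_fun_onM => //.
    exact: (sQ j [:: i; k]).
  exact: smooth_frame_coef.
- move=> y s.
  have [s2|s2] := eqVneq (size s) 2; last first.
    rewrite hQ// mulr0 big1// => i _.
    rewrite (@wedge_homogeneous _ _ 1 1)// ?mulr0// => t; first by case: t => [|? []].
    by case: t => [|? []].
  case: s s2 => [|al [|be []]]// _.
  have [/Kj jy|/f0 fy] := pselect (K y); last first.
    rewrite fy !mul0r big1// => i _; by rewrite wedge_sections /= fy !scale0r !linear0; ring.
  have Qe (be' : dual (A y)) i : Q y [:: coframe j y i; be'] =
      \sum_k be' (frame j y k) * Q y [:: coframe j y i; coframe j y k].
    rewrite {1}(coframe_expand be' jy) (multilinear_fun_sum [:: _] [::] _ _ (aQ y).1).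
    by apply: eq_bigr => k _; rewrite (multilinear_funZ [:: _] [::] _ _ (aQ y).1).
  have Qe2 (al' be' : dual (A y)) : Q y [:: al'; be'] =
      \sum_i al' (frame j y i) * Q y [:: coframe j y i; be'].
    rewrite {1}(coframe_expand al' jy) (multilinear_fun_sum [::] _ _ _ (aQ y).1).
    by apply: eq_bigr => k _; rewrite (multilinear_funZ [::] _ _ _ (aQ y).1).
  have Qb (be' : dual (A y)) i :
      be' (\sum_k Q y [:: coframe j y i; coframe j y k] *: frame j y k) =
      Q y [:: coframe j y i; be'].
    rewrite linear_sum Qe; apply: eq_bigr => k _; rewrite linearZ; exact: mulrC.
  transitivity (2^-1 * (f y * f y) * (Q y [:: al; be] - Q y [:: be; al])).
    rewrite (alternating_swap [::] _ be al (aQ y))/= opprK; by field.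
  rewrite (Qe2 al be) (Qe2 be al) -sumrB mulr_sumr; apply: eq_bigr => i _.
  rewrite wedge_sections !linearZ/= !Qb /GRing.scale/=; ring.
Qed.

End Schouten.

(** * Schouten brackets with a bivector field *)

Section SchoutenBivector.
Context (R : realType) (n : nat) (M : manifold R n) (r : nat) (A : vbundle M r)
        (L : lie_algebroid A) (B : multivector A -> multivector A -> multivector A)
        (HB : is_schouten L B).
Arguments B : clear implicits.
Implicit Types (c u v w : section A) (al be ga : cosection A).
Local Notation br := (bracket L).
Local Notation mv := multivector_of_section.

(** [u] is the contraction of [Q] with [al] in the first argument. *)
Definition is_sharp (Q : multivector A) al u :=
  smooth_section u /\
  forall y (be : dual (A y)), be (u y) = Q y [:: al y; be].

Variables (Q : multivector A) (x : M) (h : M -> R) (a b : 'I_r -> section A).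
Arguments Q : clear implicits.
Hypotheses (kQ : kvector 2 Q) (dQ : decomposition Q x h a b).

Let sa i : smooth_section (a i). Proof. exact: (decomp_left dQ). Qed.
Let sb i : smooth_section (b i). Proof. exact: (decomp_right dQ). Qed.
Let sh : smooth_fun h. Proof. exact: (decomp_fun dQ). Qed.

Lemma decomp_fun1 : h x = 1.
Proof. by have [V [_ Vx h1]] := decomp_nbhd dQ; exact: h1. Qed.

Lemma act_decomp_fun c : act L c h x = 0.
Proof. by have [V [oV Vx h1]] := decomp_nbhd dQ; exact: (tangent_near_one _ sh oV Vx h1). Qed.

Lemma schouten_decomp k P s : kvector k P ->
  B P Q x s = \sum_i 2^-1 * (wedge (B P (mv (a i)) x) (mv (b i) x) s
     + (-1) ^+ (k + 1) * wedge (mv (a i) x) (B P (mv (b i)) x) s).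
Proof.
move=> kP; have [V [oV Vx h1]] := decomp_nbhd dQ.
rewrite (schouten_localr HB s kP sh oV Vx h1 kQ.1).
rewrite (_ : (fun y t => h y * Q y t) =
   fun y t => \sum_i 2^-1 * wedge (mv (a i) y) (mv (b i) y) t); last first.
  by apply: multivectorP => y t; rewrite (decomp_eq dQ).
rewrite (schouten_sumr HB (Q := fun i y t => wedge (mv (a i) y) (mv (b i) y) t) _ _ kP.1).
  apply: eq_bigr => i _; congr (_ * _).
  have := schouten_leibniz HB kP (kvector_of_section (sa i)) (kvector_of_section (sb i)).1.
  by rewrite muln1 => ->.
move=> i; apply: (@smooth_multivector_wedge _ _ _ _ _ (mv (a i)) (mv (b i))).
  exact: (kvector_of_section (sa i)).1.
exact: (kvector_of_section (sb i)).1.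
Qed.

(** The brackets, anchors and values of [u] at [x] all follow from this
    expression of [h u], as [h] is [1] near [x]. *)
Lemma sharp_decomp al u y : is_sharp Q al u ->
  h y *: u y = \sum_i ((2^-1 * al y (a i y)) *: b i y + (- (2^-1) * al y (b i y)) *: a i y).
Proof.
move=> [su uE]; apply: covector_sep => be.
rewrite linearZ/= uE [LHS](decomp_eq dQ [:: al y; be]) linear_sum.
apply: eq_bigr => i _; rewrite wedge_sections linearD !linearZ/= /GRing.scale/=.
ring.
Qed.

Section Sharp.
Variables (al : cosection A) (u : section A).
Hypotheses (sal : smooth_cosection al) (ualp : is_sharp Q al u).

Let sp i : smooth_fun (fun y => 2^-1 * al y (a i y)).
Proof. by apply: smooth_funM; [exact: smooth_fun_cst|exact: smooth_cosection_eval]. Qed.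
Let sq i : smooth_fun (fun y => - 2^-1 * al y (b i y)).
Proof. by apply: smooth_funM; [exact: smooth_fun_cst|exact: smooth_cosection_eval]. Qed.

Lemma bracket_sharp c (be : dual (A x)) : smooth_section c ->
  be (br c u x) = \sum_i 2^-1 *
    (al x (a i x) * be (br c (b i) x) + act L c (fun y => al y (a i y)) x * be (b i x)
     - al x (b i x) * be (br c (a i) x) - act L c (fun y => al y (b i y)) x * be (a i x)).
Proof.
move=> sc.
have -> : br c u x = br c (fun y => h y *: u y) x.
  by rewrite bracketZr ?decomp_fun1 ?act_decomp_fun ?scale1r ?scale0r ?addr0//; case: ualp.
rewrite (eq_bracket L x (fun=> erefl) (fun y => sharp_decomp y ualp)).
have spb i : smooth_section (fun y => (2^-1 * al y (a i y)) *: b i y).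
  exact: smooth_sectionZ.
have sqa i : smooth_section (fun y => (- 2^-1 * al y (b i y)) *: a i y).
  exact: smooth_sectionZ.
rewrite (bracket_sumr _ _ _ (a := fun i y => (2^-1 * al y (a i y)) *: b i y +
    (- 2^-1 * al y (b i y)) *: a i y))//; last first.
  by move=> i; exact: smooth_sectionD.
rewrite linear_sum; apply: eq_bigr => i _.
rewrite bracketDr// !bracketZr//.
rewrite !actZ; try exact: smooth_cosection_eval.
rewrite !linearD !linearZ/= /GRing.scale/=; ring.
Qed.

Lemma act_sharp c be : smooth_cosection be ->
  act L c (fun y => be y (u y)) x = \sum_i 2^-1 *
    (al x (a i x) * act L c (fun y => be y (b i y)) x
     + act L c (fun y => al y (a i y)) x * be x (b i x)
     - al x (b i x) * act L c (fun y => be y (a i y)) x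
     - act L c (fun y => al y (b i y)) x * be x (a i x)).
Proof.
move=> sbe; have su := ualp.1.
have sbu : smooth_fun (fun y => be y (u y)) by exact: smooth_cosection_eval.
have -> : act L c (fun y => be y (u y)) x = act L c (fun y => h y * be y (u y)) x.
  by rewrite actM// decomp_fun1 act_decomp_fun mul1r mulr0 addr0.
rewrite (_ : (fun y => h y * be y (u y)) = (fun y => \sum_i
  ((2^-1 * al y (a i y)) * be y (b i y) + (- 2^-1 * al y (b i y)) * be y (a i y)))); last first.
  apply/funext => y; have <- : be y (h y *: u y) = h y * be y (u y) by rewrite linearZ.
  rewrite (sharp_decomp y ualp) linear_sum.
  by apply: eq_bigr => i _; rewrite linearD !linearZ.
have s1 i : smooth_fun (fun y => be y (b i y)) by exact: smooth_cosection_eval.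
have s2 i : smooth_fun (fun y => be y (a i y)) by exact: smooth_cosection_eval.
rewrite act_sum; last by move=> i; apply: smooth_funD; exact: smooth_funM.
apply: eq_bigr => i _.
rewrite actD; [|exact: smooth_funM|exact: smooth_funM].
rewrite !actM// ?act_cst; try exact: smooth_cosection_eval; try exact: smooth_fun_cst.
ring.
Qed.

Lemma anchor_sharp f : smooth_fun f ->
  act L u f x = \sum_i 2^-1 * (al x (a i x) * act L (b i) f x - al x (b i x) * act L (a i) f x).
Proof.
move=> sf; have <- : anchor L (h x *: u x) f = act L u f x by rewrite decomp_fun1 scale1r.
rewrite (sharp_decomp x ualp) anchor_sum//.
apply: eq_bigr => i _; rewrite anchorD// !anchorZ// /act; ring.
Qed.

End Sharp.

(** The Lie derivative of [Q] along [c], in terms of sharps: compare the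
    Leibniz expansions of both sides along a decomposition of [Q]. *)
Lemma schouten_section_bivector c al be u v :
  smooth_section c -> smooth_cosection al -> smooth_cosection be ->
  is_sharp Q al u -> is_sharp Q be v ->
  B (mv c) Q x [:: al x; be x] =
    al x (br v c x) - be x (br u c x) - act L c (fun y => be y (u y)) x.
Proof.
move=> sc sal sbe ual vbe.
rewrite (bracket_skew L vbe.1 sc) (bracket_skew L ual.1 sc) !linearN/=.
rewrite (bracket_sharp sal ual _ sc) (bracket_sharp sbe vbe _ sc) (act_sharp sal ual _ sbe).
rewrite (schouten_decomp _ (kvector_of_section sc)) -!sumrN -!big_split.
apply: eq_bigr => i _ /=.
rewrite !(schouten_sections HB)// !wedge_sections; ring.
Qed.

(** [Q, Q] measures the failure of sharp to preserve brackets. The Leibniz rule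
    on one of the two copies of [Q] reduces it to Lie derivatives of the other
    along [a i] and [b i]; their derivative terms add up to anchors of sharps,
    and the rest is expanded along the decomposition. *)
Lemma schouten_bivector al be ga u v w :
  smooth_cosection al -> smooth_cosection be -> smooth_cosection ga ->
  is_sharp Q al u -> is_sharp Q be v -> is_sharp Q ga w ->
  B Q Q x [:: al x; be x; ga x] =
    - 2 * (al x (br v w x) + be x (br w u x) + ga x (br u v x)
           - act L u (fun y => ga y (v y)) x + act L v (fun y => ga y (u y)) x
           - act L w (fun y => be y (u y)) x).
Proof.
move=> sal sbe sga ual vbe wga.
have sym c : smooth_section c -> B Q (mv c) = B (mv c) Q.
  move=> sc; rewrite (schouten_sym HB kQ (kvector_of_section sc)).
  by apply: multivectorP => y s; rewrite muln1 expr2 mulrNN !mul1r.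
rewrite (schouten_decomp _ kQ).
have bu : smooth_fun (fun y => be y (u y)) by exact: (smooth_cosection_eval sbe ual.1).
have gu : smooth_fun (fun y => ga y (u y)) by exact: (smooth_cosection_eval sga ual.1).
have gv : smooth_fun (fun y => ga y (v y)) by exact: (smooth_cosection_eval sga vbe.1).
(* [E i] collects the terms with a Lie bracket *)
pose E i := 2^-1 *
  (ga x (b i x) * (al x (br v (a i) x) - be x (br u (a i) x))
   - be x (b i x) * (al x (br w (a i) x) - ga x (br u (a i) x))
   + al x (b i x) * (be x (br w (a i) x) - ga x (br v (a i) x))
   - ga x (a i x) * (al x (br v (b i) x) - be x (br u (b i) x))
   + be x (a i x) * (al x (br w (b i) x) - ga x (br u (b i) x))
   - al x (a i x) * (be x (br w (b i) x) - ga x (br v (b i) x))).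
transitivity (\sum_i E i + (act L u (fun y => ga y (v y)) x
    - act L v (fun y => ga y (u y)) x + act L w (fun y => be y (u y)) x)).
  rewrite (anchor_sharp ual gv) (anchor_sharp vbe gu) (anchor_sharp wga bu).
  rewrite -!sumrN -!big_split; apply: eq_bigr => i _ /=; rewrite !sym//.
  rewrite !wedge_cons !wedge_nil/= /multivector_of_section/=.
  rewrite !(schouten_section_bivector _ sal sbe ual vbe)//.
  rewrite !(schouten_section_bivector _ sal sga ual wga)//.
  rewrite !(schouten_section_bivector _ sbe sga vbe wga)//.
  rewrite /E; ring.
(* antisymmetrised, so that each sharp gets expanded in turn *)
have sk p q (th : dual (A x)) : smooth_section p -> smooth_section q ->
    th (br p q x) = 2^-1 * (th (br p q x) - th (br q p x)).
  by move=> sp sq; rewrite (bracket_skew L sq sp) linearN; field.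
have su := ual.1; have sv := vbe.1; have sw := wga.1.
rewrite (sk v w (al x) sv sw) (sk w u (be x) sw su) (sk u v (ga x) su sv).
rewrite (act_sharp sbe vbe _ sga) (act_sharp sal ual v sga) (act_sharp sal ual w sbe).
rewrite (bracket_sharp sbe vbe (al x) sw) (bracket_sharp sga wga (al x) sv).
rewrite (bracket_sharp sal ual (be x) sw) (bracket_sharp sga wga (be x) su).
rewrite (bracket_sharp sal ual (ga x) sv) (bracket_sharp sbe vbe (ga x) su).
apply/eqP; rewrite -subr_eq0; apply/eqP.
rewrite -!sumrN -!big_split/= !mulr_sumr -!big_split/= !mulr_sumr -?sumrN -!big_split/=.
by apply: big1 => i _; rewrite /E; field.
Qed.

End SchoutenBivector.

(** * The fundamental bivector *)

Lemma smooth_det (R : realType) (n : nat) (M : manifold R n) (U : set M) k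
    (G : M -> 'M[R]_k) : open U ->
  (forall i l, smooth_fun_on U (fun y => G y i l)) ->
  smooth_fun_on U (fun y => \det (G y)).
Proof.
move=> oU sG; apply: smooth_fun_on_sum => // s _; apply: smooth_fun_onM => //.
  exact: smooth_fun_on_cst.
by apply: smooth_fun_on_prod => // i _; exact: sG.
Qed.

Lemma smooth_invmx (R : realType) (n : nat) (M : manifold R n) (U : set M) k
    (G : M -> 'M[R]_k) i l : open U ->
  (forall i l, smooth_fun_on U (fun y => G y i l)) ->
  (forall y, U y -> \det (G y) != 0) ->
  smooth_fun_on U (fun y => invmx (G y) i l).
Proof.
move=> oU sG G0.
apply: (@eq_smooth_fun_on _ _ _ _ _ (fun y => (\det (G y))^-1 *
    ((-1) ^+ (l + i) * \det (row' l (col' i (G y)))))) => //.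
  by move=> y Uy; rewrite /invmx unitmxE unitfE G0// !mxE.
apply: smooth_fun_onM => //.
  by apply: smooth_fun_onV => //; exact: smooth_det.
apply: smooth_fun_onM => //; first exact: smooth_fun_on_cst.
apply: (@smooth_det _ _ _ _ _ (fun y => row' l (col' i (G y)))) => // i' l'.
apply: (@eq_smooth_fun_on _ _ _ _ _ (fun y => G y (lift l i') (lift i l'))) => //.
by move=> y _; rewrite !mxE.
Qed.

Section Cosymplectic.
Context (R : realType) (n m : nat) (M : manifold R n) (A : vbundle M (2 * m + 1))
        (Om : diff_form A) (eta : cosection A) (xi : section A).
Arguments Om : clear implicits.
Hypotheses (Hcos : almost_cosymplectic m Om eta) (Hxi : reeb_section Om eta xi).
Implicit Types (x y : M) (a b c : section A).

Let sOm : smooth_form Om. Proof. by case: Hcos => -[]. Qed.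
Let hOm x : homogeneous 2 (Om x). Proof. by case: Hcos => -[]. Qed.
Let aOm x : alternating (Om x). Proof. by case: sOm. Qed.
Let seta : smooth_cosection eta. Proof. by case: Hcos. Qed.
Let sxi : smooth_section xi. Proof. by case: Hxi. Qed.
Let etaxi x : eta x (xi x) = 1. Proof. by case: Hxi. Qed.

Lemma OmC x (u v : A x) : Om x [:: u; v] = - Om x [:: v; u].
Proof. exact: (alternating_swap [::] [::] u v (aOm x)). Qed.

Lemma Om_linearr x (u v w : A x) k :
  Om x [:: u; k *: v + w] = k * Om x [:: u; v] + Om x [:: u; w].
Proof. exact: ((aOm x).1 [:: u] [::]). Qed.

Lemma Om_linearl x (u v w : A x) k :
  Om x [:: k *: v + w; u] = k * Om x [:: v; u] + Om x [:: w; u].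
Proof. exact: ((aOm x).1 [::] [:: u]). Qed.

Lemma Om_xil x (v : A x) : Om x [:: xi x; v] = 0.
Proof. by case: Hxi. Qed.

Lemma Om_xir x (v : A x) : Om x [:: v; xi x] = 0.
Proof. by rewrite OmC Om_xil oppr0. Qed.

Lemma Om0l x (v : A x) : Om x [:: 0; v] = 0.
Proof. exact: (multilinear_fun0 [::] [:: v] (aOm x).1). Qed.

Lemma smooth_Om a b : smooth_section a -> smooth_section b ->
  smooth_fun (fun y => Om y [:: a y; b y]).
Proof.
move=> sa sb; apply: (@smooth_form_eval _ _ _ _ _ Om [:: a; b]) => // -[|[|i]]//=.
by rewrite nth_nil; exact: smooth_section0.
Qed.

Let etaP x (u v : A x) k : eta x (k *: u + v) = k * eta x u + eta x v.
Proof. exact: linearP. Qed.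

(** The covector [- i_a Om + k eta]. *)
Definition covector x (a : A x) (k : R) : dual (A x) :=
  linfun (fun b : A x => - Om x [:: a; b] + k * eta x b : R^o).

Lemma covectorE x (a b : A x) k : covector a k b = - Om x [:: a; b] + k * eta x b.
Proof.
rewrite /covector linfunE// => l u v; rewrite Om_linearr etaP /GRing.scale/=; ring.
Qed.

Lemma flatE x (a : A x) : flat Om eta x a = covector a (eta x a).
Proof.
rewrite /flat linfunE => [//|l u v]; apply/lfunP => b.
rewrite add_lfunE scale_lfunE -![linfun _]/(covector _ _) !covectorE.
rewrite Om_linearl etaP /GRing.scale/=; ring.
Qed.

Lemma smooth_covector a k : smooth_section a -> smooth_cosection (fun y => covector (a y) k).
Proof.
move=> sa j i; have oj := @tdom_open _ _ _ _ A j.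
apply: (@eq_smooth_fun_on _ _ _ _ _ (fun y => - (\sum_l coframe j y l (a y) *
   Om y [:: frame j y l; frame j y i]) + k * eta y (frame j y i))) => //.
  move=> y jy; rewrite covectorE {1}(frame_expand (a y) jy).
  rewrite (multilinear_fun_sum [::] _ _ _ (aOm y).1).
  congr (- _ + _); apply: eq_bigr => l _.
  by rewrite (multilinear_funZ [::] _ _ _ (aOm y).1).
apply: smooth_fun_onD => //; last first.
  by apply: smooth_fun_onM => //; exact: smooth_fun_on_cst.
apply: smooth_fun_onN => //; apply: smooth_fun_on_sum => // l _.
apply: smooth_fun_onM => //; first exact: smooth_coframe.
exact: (sOm.2 j [:: l; i]).
Qed.

Lemma wedge_exp_homogeneous x k : homogeneous (k * 2) (wedge_exp (Om x) k).
Proof.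
elim: k => [|k IH]; first by case.
by rewrite (mulSn k); apply: wedge_homogeneous => //; exact: hOm.
Qed.

Lemma alternating_wedge_exp x k : alternating (wedge_exp (Om x) k).
Proof.
elim: k => [|k IH]; first exact: alternating_nilp.
exact: alternating_wedge.
Qed.

(** Evaluating at [xi], a vector in the kernel annihilates [eta] and [Om], hence
    the nonzero top form [eta /\ Om^m]. *)
Lemma flat_inj x : lker (flat Om eta x) == 0%VS.
Proof.
rewrite -subv0; apply/subvP => a; rewrite memv_ker memv0 => /eqP/lfunP a0.
have Ha (b : A x) : - Om x [:: a; b] + eta x a * eta x b = 0.
  by have := a0 b; rewrite flatE covectorE zero_lfunE.
have ea : eta x a = 0 by have := Ha (xi x); rewrite Om_xir etaxi oppr0 add0r mulr1.
have Oa (b : A x) : Om x [:: a; b] = 0.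
  by have := Ha b; rewrite ea mul0r addr0 => /eqP; rewrite oppr_eq0 => /eqP.
apply/eqP/eqP; apply: contrapT => /negP an0.
have [_ _ /(_ x)[s /eqP[]]] := Hcos.
apply: (top_form_annihilated (dim_fibre A x) _ _ an0).
- by apply: alternating_wedge; [exact: alternating_oneform|exact: alternating_wedge_exp].
- move=> t ht; have E : (1 + m * 2 = 2 * m + 1)%N by rewrite addnC mulnC.
  apply: (@wedge_homogeneous _ _ 1 (m * 2)); last by rewrite E.
    by move=> [|? []].
  exact: wedge_exp_homogeneous.
- apply: annihilates_wedge.
    by move=> [|v [|? ?]]//; rewrite inE => /eqP <-.
  suff: forall k, annihilates a (wedge_exp (Om x) k) by [].
  elim=> [|k IH]; first by case.
  apply: annihilates_wedge => // t.
  have [|t2 _] := eqVneq (size t) 2; last exact: hOm.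
  case: t => [|u [|v []]]// _; rewrite !inE => /orP[]/eqP <- //.
  by rewrite OmC Oa oppr0.
Qed.

Lemma flatK x (a : A x) : sharp Om eta x (flat Om eta x a) = a.
Proof. exact: (lker0_lfunK (flat_inj x)). Qed.

Lemma sharpK x (al : dual (A x)) : flat Om eta x (sharp Om eta x al) = al.
Proof.
rewrite /sharp limg_lfunVK//.
have -> : limg (flat Om eta x) = fullv; last exact: memvf.
apply/eqP; rewrite eqEdim subvf/= limg_dim_eq; last first.
  by rewrite (eqP (flat_inj x)) capv0.
by rewrite !dimvf /= /dim/= muln1.
Qed.

Lemma eta_sharp x (al : dual (A x)) : eta x (sharp Om eta x al) = al (xi x).
Proof. by rewrite -[in RHS](sharpK al) flatE covectorE Om_xir etaxi oppr0 add0r mulr1. Qed.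

Lemma sharp_covector x (a : A x) k : eta x a = 0 ->
  sharp Om eta x (covector a k) = k *: xi x + a.
Proof.
move=> ea; rewrite -[RHS]flatK; congr (sharp _ _ _ _); rewrite flatE.
apply/lfunP => b; rewrite !covectorE Om_linearl Om_xil mulr0 add0r.
by rewrite etaP etaxi ea addr0 mulr1.
Qed.

Local Notation Pi := (fundamental_bivector Om eta).

Lemma fundamental_bivector_covector x (a : A x) k (be : dual (A x)) : eta x a = 0 ->
  Pi x [:: covector a k; be] = be a.
Proof.
move=> ea; rewrite /fundamental_bivector sharp_covector// Om_linearl Om_xil mulr0 add0r.
rewrite -[in RHS](sharpK be) flatE covectorE ea mulr0 addr0; exact: OmC.
Qed.

Lemma alternating_fundamental_bivector x : alternating (Pi x).
Proof.
split=> [s t k al be|[|al [|be [|? ?]]]//].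
  case: s => [|u [|v s]]/=; last by case: s => [|? ?]; rewrite /= mulr0 addr0.
    case: t => [|v [|? ?]]; rewrite /= ?mulr0 ?addr0//.
    by rewrite linearP Om_linearl.
  by case: t => [|? ?]; rewrite /= ?mulr0 ?addr0// linearP Om_linearr.
rewrite /= inE andbT negbK => /eqP ->.
by apply: (aOm x).2; rewrite /= inE eqxx.
Qed.

(** In a frame, the sharps of the coframe are the rows of the inverse of the
    matrix [G] of the musical map. *)
Lemma smooth_fundamental_bivector : smooth_multivector Pi.
Proof.
split; first exact: alternating_fundamental_bivector.
move=> j s; have oj := @tdom_open _ _ _ _ A j.
case: s => [|i [|l [|? ?]]]; try exact: smooth_fun_on_cst.
pose G y := \matrix_(k, k') flat Om eta y (frame j y k) (frame j y k').
have GE y k k' : G y k k' =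
    - Om y [:: frame j y k; frame j y k'] + eta y (frame j y k) * eta y (frame j y k').
  by rewrite mxE flatE covectorE.
have sG k k' : smooth_fun_on (tdom j) (fun y => G y k k').
  apply: (eq_smooth_fun_on oj (fun y _ => GE y k k')).
  apply: smooth_fun_onD => //; last first.
    by apply: smooth_fun_onM.
  by apply: smooth_fun_onN => //; exact: (sOm.2 j [:: k; k']).
have comb y (v : 'rV[R]_(2 * m + 1)) k' :
    flat Om eta y (\sum_k v ord0 k *: frame j y k) (frame j y k') = (v *m G y) ord0 k'.
  rewrite linear_sum sum_lfunE mxE; apply: eq_bigr => k _.
  by rewrite linearZ scale_lfunE mxE.
have dG y : tdom j y -> \det (G y) != 0.
  move=> jy; apply/negP => /det0P[v v0 vG]; case/eqP: v0.
  have : \sum_k v ord0 k *: frame j y k = 0.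
    rewrite -[LHS]flatK (_ : flat _ _ _ _ = 0) ?linear0//.
    rewrite [LHS](coframe_expand _ jy) big1// => k' _.
    by rewrite comb vG mxE scale0r.
  move=> /(congr1 (fun u => triv j y u)); rewrite linear_sum linear0 => v0.
  apply/rowP => k; have /rowP/(_ k) vk := v0; rewrite -[RHS]vk.
  rewrite summxE (bigD1 k)//= linearZ mxE -coframeE coframe_frame// eqxx mulr1.
  rewrite big1 ?addr0// => k' kk'.
  by rewrite linearZ mxE -coframeE coframe_frame// eq_sym (negbTE kk') mulr0.
have shE y i' : tdom j y ->
    sharp Om eta y (coframe j y i') = \sum_k invmx (G y) i' k *: frame j y k.
  move=> jy; rewrite -[RHS]flatK; congr (sharp _ _ _ _).
  rewrite [LHS](coframe_expand _ jy) [RHS](coframe_expand _ jy).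
  apply: eq_bigr => k' _; congr (_ *: _).
  have := comb y (row i' (invmx (G y))) k'.
  under eq_bigr do rewrite mxE.
  move=> ->; rewrite -row_mul mulVmx ?unitmxE ?unitfE ?dG// !mxE coframe_frame//.
apply: (@eq_smooth_fun_on _ _ _ _ _ (fun y => \sum_k \sum_k' invmx (G y) i k *
    (invmx (G y) l k' * Om y [:: frame j y k; frame j y k']))) => //.
  move=> y jy; rewrite /= !shE// (multilinear_fun_sum [::] _ _ _ (aOm y).1).
  apply: eq_bigr => k _; rewrite (multilinear_funZ [::] _ _ _ (aOm y).1).
  rewrite (multilinear_fun_sum [:: _] [::] _ _ (aOm y).1) mulr_sumr.
  by apply: eq_bigr => k' _; rewrite (multilinear_funZ [:: _] [::] _ _ (aOm y).1).
apply: smooth_fun_on_sum => // k _; apply: smooth_fun_on_sum => // k' _.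
apply: smooth_fun_onM => //; first exact: smooth_invmx.
apply: smooth_fun_onM => //; first exact: smooth_invmx.
exact: (sOm.2 j [:: k; k']).
Qed.

Lemma kvector_fundamental_bivector : kvector 2 Pi.
Proof.
split; first exact: smooth_fundamental_bivector.
by move=> x [|? [|? [|? ?]]].
Qed.

Lemma is_sharp_covector a k : smooth_section a -> (forall y, eta y (a y) = 0) ->
  is_sharp Pi (fun y => covector (a y) k) a.
Proof. by move=> sa ea; split=> // y be; rewrite fundamental_bivector_covector. Qed.

Definition horizontal_part a : section A := fun y => a y - eta y (a y) *: xi y.

Lemma smooth_horizontal_part a : smooth_section a -> smooth_section (horizontal_part a).
Proof.
move=> sa; apply: smooth_sectionD => //; apply: smooth_sectionN.
by apply: smooth_sectionZ => //; exact: smooth_cosection_eval.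
Qed.

Lemma eta_horizontal_part a y : eta y (horizontal_part a y) = 0.
Proof. by rewrite linearB linearZ/= etaxi [_ *: _]mulr1 subrr. Qed.

(** [a] is the horizontal part of the sharp of [al], and [k] is [al xi]. *)
Lemma covector_exists x (al : dual (A x)) : exists a k,
  [/\ smooth_section a, forall y, eta y (a y) = 0 & al = covector (a x) k].
Proof.
exists (horizontal_part (extend (sharp Om eta x al))), (al (xi x)); split.
- by apply: smooth_horizontal_part; exact: smooth_extend.
- exact: eta_horizontal_part.
- rewrite -[LHS]sharpK flatE eta_sharp; apply/lfunP => b.
  rewrite !covectorE /horizontal_part extendE; congr (- _ + _).
  by rewrite addrC -scaleNr Om_linearl Om_xil mulr0 add0r.
Qed.

End Cosymplectic.

(** * The exterior differential of a one-form *)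

Section ExteriorDifferential.
Context (R : realType) (n r : nat) (M : manifold R n) (A : vbundle M r) (L : lie_algebroid A)
        (eta : cosection A).
Hypothesis seta : smooth_cosection eta.
Implicit Types (x y : M) (a b c : section A).
Local Notation br := (bracket L).

(** The exterior differential of [eta] on global sections; [ext_diff] evaluates
    it on extensions of vectors. *)
Definition d_oneform a b x : R :=
  act L a (fun y => eta y (b y)) x - act L b (fun y => eta y (a y)) x - eta x (br a b x).

Let se a : smooth_section a -> smooth_fun (fun y => eta y (a y)).
Proof. exact: smooth_cosection_eval. Qed.

Lemma d_oneformC a b x : smooth_section a -> smooth_section b ->
  d_oneform a b x = - d_oneform b a x.
Proof.
by move=> sa sb; rewrite /d_oneform (bracket_skew L sa sb) linearN/=; ring.
Qed.

Lemma d_oneformDl a b c x : smooth_section a -> smooth_section b -> smooth_section c ->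
  d_oneform (fun y => a y + b y) c x = d_oneform a c x + d_oneform b c x.
Proof.
move=> sa sb sc; rewrite /d_oneform bracketDl// linearD/= {1}/act anchorD; last exact: se.
rewrite (_ : (fun y => eta y (a y + b y)) = (fun y => eta y (a y) + eta y (b y))); last first.
  by apply/funext => y; rewrite linearD.
by rewrite actD; [rewrite /act; ring|exact: se|exact: se].
Qed.

Lemma d_oneformZl f a c x : smooth_fun f -> smooth_section a -> smooth_section c ->
  d_oneform (fun y => f y *: a y) c x = f x * d_oneform a c x.
Proof.
move=> sf sa sc; rewrite /d_oneform bracketZl// linearB !linearZ/=.
rewrite {1}/act anchorZ; last exact: se.
rewrite (_ : (fun y => eta y (f y *: a y)) = (fun y => f y * eta y (a y))); last first.
  by apply/funext => y; rewrite linearZ.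
by rewrite actM//; [rewrite /act /GRing.scale/=; ring|exact: se].
Qed.

Lemma d_oneform_locall a b c x : smooth_section a -> smooth_section b -> smooth_section c ->
  a x = b x -> d_oneform a c x = d_oneform b c x.
Proof.
move=> sa sb sc; apply: (@tensorial_local _ _ _ _ _ x (fun a => d_oneform a c x)) => //.
  by move=> *; exact: d_oneformDl.
by move=> *; exact: d_oneformZl.
Qed.

Lemma d_oneform_local a a' b b' x : smooth_section a -> smooth_section a' ->
  smooth_section b -> smooth_section b' -> a x = a' x -> b x = b' x ->
  d_oneform a b x = d_oneform a' b' x.
Proof.
move=> sa sa' sb sb' aa' bb'; rewrite (d_oneform_locall sa sa' sb aa').
by rewrite d_oneformC// (d_oneform_locall sb sb' sa' bb') -d_oneformC.
Qed.

Lemma ext_diff_oneform x (u v : A x) :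
  ext_diff L (form_of_cosection eta) x [:: u; v] = d_oneform (extend u) (extend v) x.
Proof.
rewrite /ext_diff /tensor_at/=.
rewrite !big_ord_recl !big_ord0/=.
rewrite big_mkcond !big_ord_recl !big_ord0/=.
rewrite [X in _ + (_ + (X + _))]big1 => [|[[|[|]]]//].
by rewrite /omit/= /eval_form/= /bump/= /d_oneform; ring.
Qed.

Lemma ext_diff_oneform_homogeneous x :
  homogeneous 2 (ext_diff L (form_of_cosection eta) x).
Proof.
move=> s s2; rewrite /ext_diff /tensor_at size_map.
have e0 (t : seq (section A)) : size t != 1%N -> eval_form (form_of_cosection eta) t = fun=> 0.
  by move=> t1; apply/funext => y; rewrite /eval_form; case: t t1 => [|? [|? ?]].
have so (T : Type) (t : seq T) i : (i < size t)%N -> size (omit i t) = (size t).-1.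
  by move=> it; rewrite /omit size_cat size_takel ?size_drop; lia.
rewrite !big1 ?addr0// => i _.
  apply: big1 => j ij; have jlt := ltn_ord j.
  have sj : size (omit j (map (extend (A := A) (x := x)) s)) = (size s).-1.
    by rewrite so size_map.
  rewrite e0 ?mulr0//= so sj; move: s2 ij jlt; lia.
rewrite e0 ?act_cst ?mulr0// so ?size_map//; have := ltn_ord i; lia.
Qed.

Lemma exterior_differentialE (Om : diff_form A) : kform 2 Om ->
  Om = ext_diff L (form_of_cosection eta) <->
  forall a b x, smooth_section a -> smooth_section b ->
    Om x [:: a x; b x] = d_oneform a b x.
Proof.
move=> kOm; split=> [OmE a b x sa sb|OmE].
  rewrite OmE ext_diff_oneform.
  by apply: d_oneform_local; rewrite ?extendE//; exact: smooth_extend.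
apply: functional_extensionality_dep => x; apply/funext => s.
have [s2|s2] := eqVneq (size s) 2; last first.
  by rewrite (kOm.2 x)// ext_diff_oneform_homogeneous.
case: s s2 => [|u [|v []]]// _; rewrite ext_diff_oneform -OmE; try exact: smooth_extend.
by rewrite !extendE.
Qed.

End ExteriorDifferential.

(** * Contact and Jacobi structures *)

Section ContactJacobi.
Context (R : realType) (n m : nat) (M : manifold R n) (A : vbundle M (2 * m + 1))
        (L : lie_algebroid A) (B : multivector A -> multivector A -> multivector A)
        (HB : is_schouten L B) (Om : diff_form A) (eta : cosection A) (xi : section A).
Arguments B : clear implicits.
Arguments Om : clear implicits.
Local Arguments fundamental_bivector : simpl never.
Hypotheses (Hcos : almost_cosymplectic m Om eta) (Hxi : reeb_section Om eta xi).
Implicit Types (x y : M) (a b c : section A).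
Local Notation br := (bracket L).
Local Notation mv := multivector_of_section.
Local Notation Pi := (fundamental_bivector Om eta).
Local Notation d_eta := (d_oneform L eta).
Local Notation cov := (covector Om eta).

Let seta : smooth_cosection eta. Proof. by case: Hcos. Qed.
Let sxi : smooth_section xi. Proof. by case: Hxi. Qed.
Let etaxi x : eta x (xi x) = 1. Proof. by case: Hxi. Qed.
Let kPi : kvector 2 Pi. Proof. exact: kvector_fundamental_bivector Hcos Hxi. Qed.

Definition is_horizontal a := smooth_section a /\ forall y, eta y (a y) = 0.

Let smooth_cov a k : smooth_section a -> smooth_cosection (fun y => cov (a y) k).
Proof. exact: (smooth_covector Hcos). Qed.

Let sharp_cov a k : is_horizontal a -> is_sharp Pi (fun y => cov (a y) k) a.
Proof. by move=> [sa ea]; exact: (is_sharp_covector Hcos Hxi). Qed.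

Lemma covector_fun a b k : is_horizontal b ->
  (fun y => cov (a y) k (b y)) = (fun y => Om y [:: b y; a y]).
Proof.
by move=> [_ eb]; apply/funext => y; rewrite (covectorE Hcos) eb mulr0 addr0 -(OmC Hcos).
Qed.

(** With the covectors [- i_a Om + k eta], the bracket with [xi] is minus the
    Lie derivative of [Om] along [xi], plus terms in [eta]. *)
Lemma schouten_reeb a b (k l : R) x : is_horizontal a -> is_horizontal b ->
  B (mv xi) Pi x [:: cov (a x) k; cov (b x) l] =
    Om x [:: b x; br a xi x] - Om x [:: a x; br b xi x]
    - act L xi (fun y => Om y [:: a y; b y]) x
    + k * eta x (br b xi x) - l * eta x (br a xi x).
Proof.
move=> ha hb; have [h [a' [b' dPi]]] := decomposition_exists x kPi.
rewrite (schouten_section_bivector HB kPi dPi sxi (smooth_cov k ha.1) (smooth_cov l hb.1)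
  (sharp_cov k ha) (sharp_cov l hb)).
by rewrite covector_fun// !(covectorE Hcos); ring.
Qed.

Lemma schouten_fundamental a b c (k l p : R) x :
  is_horizontal a -> is_horizontal b -> is_horizontal c ->
  B Pi Pi x [:: cov (a x) k; cov (b x) l; cov (c x) p] =
    2 * (Om x [:: a x; br b c x] + Om x [:: b x; br c a x] + Om x [:: c x; br a b x]
      - (k * eta x (br b c x) + l * eta x (br c a x) + p * eta x (br a b x))
      + act L a (fun y => Om y [:: b y; c y]) x - act L b (fun y => Om y [:: a y; c y]) x
      + act L c (fun y => Om y [:: a y; b y]) x).
Proof.
move=> ha hb hc; have [h [a' [b' dPi]]] := decomposition_exists x kPi.
rewrite (schouten_bivector HB kPi dPi (smooth_cov k ha.1) (smooth_cov l hb.1)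
  (smooth_cov p hc.1) (sharp_cov k ha) (sharp_cov l hb) (sharp_cov p hc)).
by rewrite !covector_fun// !(covectorE Hcos); ring.
Qed.

Lemma wedge_reeb a b c (k l p : R) x : is_horizontal a -> is_horizontal b -> is_horizontal c ->
  wedge (mv xi x) (Pi x) [:: cov (a x) k; cov (b x) l; cov (c x) p] =
    k * Om x [:: b x; c x] - l * Om x [:: a x; c x] + p * Om x [:: a x; b x].
Proof.
move=> ha hb hc; rewrite !wedge_cons !wedge_nil.
have cx u q : cov (u x) q (xi x) = q.
  by rewrite (covectorE Hcos) (Om_xir Hcos Hxi) etaxi; ring.
have PiE u v q q' : is_horizontal u -> is_horizontal v ->
    Pi x [:: cov (u x) q; cov (v x) q'] = Om x [:: u x; v x].
  move=> [_ eu] _; rewrite (fundamental_bivector_covector Hcos Hxi)//.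
  by rewrite (covectorE Hcos) eu mulr0 addr0 -(OmC Hcos).
rewrite /multivector_of_section/= !cx !PiE//; ring.
Qed.

Lemma schouten_section_homogeneous c x :
  smooth_section c -> homogeneous 2 (B (mv c) Pi x).
Proof.
move=> sc s s2; have [h [a [b dPi]]] := decomposition_exists x kPi.
rewrite (schouten_decomp HB kPi dPi s (kvector_of_section sc)) big1// => i _.
rewrite !(schouten_sections HB)//; try exact: (decomp_left dPi); try exact: (decomp_right dPi).
have h1 (u : section A) : homogeneous 1 (mv u x) by case=> [|? []].
by rewrite !(wedge_homogeneous (h1 _) (h1 _)) ?mulr0 ?addr0 ?mulr0.
Qed.

Lemma schouten_fundamental_homogeneous x : homogeneous 3 (B Pi Pi x).
Proof.
move=> s s3; have [h [a [b dPi]]] := decomposition_exists x kPi.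
rewrite (schouten_decomp HB kPi dPi s kPi) big1// => i _.
have h1 (u : section A) : homogeneous 1 (mv u x) by case=> [|? []].
have h2 u : smooth_section u -> homogeneous 2 (B Pi (mv u) x).
  move=> su t t2; rewrite (schouten_sym HB kPi (kvector_of_section su)).
  by rewrite schouten_section_homogeneous// mulr0.
rewrite (wedge_homogeneous (h2 _ (decomp_left dPi i)) (h1 _))//.
by rewrite (wedge_homogeneous (h1 _) (h2 _ (decomp_right dPi i)))// !mulr0 addr0 mulr0.
Qed.

Lemma is_horizontal0 : is_horizontal (fun=> 0).
Proof. by split; [exact: smooth_section0|move=> y; rewrite linear0]. Qed.

Lemma horizontal_partP a :
  smooth_section a -> is_horizontal (horizontal_part eta xi a).
Proof.
move=> sa; split; first exact: (smooth_horizontal_part Hcos Hxi).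
exact: (eta_horizontal_part Hxi).
Qed.

Section ContactToJacobi.
Hypothesis contact : forall a b x, smooth_section a -> smooth_section b ->
  Om x [:: a x; b x] = d_eta a b x.

Lemma contact_hor a b x : is_horizontal a -> is_horizontal b ->
  Om x [:: a x; b x] = - eta x (br a b x).
Proof.
move=> [sa ea] [sb eb]; rewrite contact// /d_oneform.
rewrite (_ : (fun y => eta y (b y)) = fun=> 0); last exact/funext.
rewrite (_ : (fun y => eta y (a y)) = fun=> 0); last exact/funext.
by rewrite !act_cst; ring.
Qed.

Lemma contact_reeb b x : smooth_section b ->
  eta x (br xi b x) = act L xi (fun y => eta y (b y)) x.
Proof.
move=> sb; have := contact x sxi sb; rewrite (Om_xil Hxi) /d_oneform.
rewrite (_ : (fun y => eta y (xi y)) = fun=> 1); last exact/funext.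
rewrite act_cst; lra.
Qed.

Lemma contact_hor_reeb a : is_horizontal a -> is_horizontal (br a xi).
Proof.
move=> [sa ea]; split=> [|y]; first exact: bracket_smooth.
rewrite bracket_skew// linearN/= contact_reeb//.
rewrite (_ : (fun y => eta y (a y)) = fun=> 0); last exact/funext.
by rewrite act_cst oppr0.
Qed.

(** All terms reduce to [eta] of the Jacobi sum of [a], [b] and [xi]. *)
Lemma contact_schouten_reeb : B (mv xi) Pi = (fun _ _ => 0).
Proof.
apply: multivectorP => x s.
have [s2|s2] := eqVneq (size s) 2; last exact: schouten_section_homogeneous.
case: s s2 => [|al [|be []]]// _.
have [a [k [sa ea ->]]] := covector_exists Hcos Hxi al.
have [b [l [sb eb ->]]] := covector_exists Hcos Hxi be.
have ha : is_horizontal a by [].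
have hb : is_horizontal b by [].
have hax := contact_hor_reeb ha; have hbx := contact_hor_reeb hb.
rewrite schouten_reeb// hax.2 hbx.2 !contact_hor//.
have -> : (fun y => Om y [:: a y; b y]) = (fun y => -1 * eta y (br a b y)).
  by apply/funext => y; rewrite contact_hor// mulN1r.
have sab : smooth_section (br a b) by exact: bracket_smooth.
rewrite actZ; last exact: smooth_cosection_eval.
rewrite -contact_reeb//.
have E : br b (br a xi) x = - br b (br xi a) x.
  rewrite -(bracketNr L)//; last exact: bracket_smooth.
  by apply: eq_bracket => // y; rewrite bracket_skew.
have := congr1 (eta x) (bracket_jacobi L sa sb sxi x).
rewrite linear0 !linearD/= E linearN/=; lra.
Qed.

(** As [eta [b, c] = - Om (b, c)] for horizontal [b] and [c], the terms in [k],
    [l], [p] give [2 xi /\ Pi]; the rest is [eta] of the Jacobi sum of [a], [b],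
    [c]. *)
Lemma contact_schouten :
  B Pi Pi = (fun x s => 2 * wedge (mv xi x) (Pi x) s).
Proof.
apply: multivectorP => x s.
have [s3|s3] := eqVneq (size s) 3; last first.
  rewrite schouten_fundamental_homogeneous// (@wedge_homogeneous _ _ 1 2) ?mulr0//.
    by case=> [|? []].
  exact: kPi.2.
case: s s3 => [|al [|be [|ga []]]]// _.
have [a [k [sa ea ->]]] := covector_exists Hcos Hxi al.
have [b [l [sb eb ->]]] := covector_exists Hcos Hxi be.
have [c [p [sc ec ->]]] := covector_exists Hcos Hxi ga.
have ha : is_horizontal a by [].
have hb : is_horizontal b by [].
have hc : is_horizontal c by [].
rewrite schouten_fundamental// wedge_reeb//.
have Oact u v w : is_horizontal u -> is_horizontal v -> is_horizontal w ->
    act L u (fun y => Om y [:: v y; w y]) x = - act L u (fun y => eta y (br v w y)) x.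
  move=> hu hv hw.
  have -> : (fun y => Om y [:: v y; w y]) = (fun y => -1 * eta y (br v w y)).
    by apply/funext => y; rewrite contact_hor// mulN1r.
  rewrite actZ ?mulN1r//; apply: smooth_cosection_eval => //.
  by apply: bracket_smooth; [case: hv|case: hw].
have Obr u v w : is_horizontal u -> is_horizontal v -> is_horizontal w ->
    Om x [:: u x; br v w x] = act L u (fun y => eta y (br v w y)) x - eta x (br u (br v w) x).
  move=> [su eu] [sv _] [sw _]; rewrite contact//; last exact: bracket_smooth.
  rewrite /d_oneform (_ : (fun y => eta y (u y)) = fun=> 0); last exact/funext.
  by rewrite act_cst; ring.
have -> : (fun y => Om y [:: a y; c y]) = (fun y => -1 * Om y [:: c y; a y]).
  by apply/funext => y; rewrite (OmC Hcos) mulN1r.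
rewrite actZ; last exact: (smooth_Om Hcos).
rewrite !Obr// !Oact// (contact_hor x hb hc) (contact_hor x ha hb).
rewrite (OmC Hcos (a x) (c x)) (contact_hor x hc ha).
have := congr1 (eta x) (bracket_jacobi L sa sb sc x).
rewrite linear0 !linearD/=; lra.
Qed.

End ContactToJacobi.

Section JacobiToContact.
Hypothesis schouten_eq : B Pi Pi = (fun x s => 2 * wedge (mv xi x) (Pi x) s).
Hypothesis reeb_eq : B (mv xi) Pi = (fun _ _ => 0).

(** Evaluate on [eta], [- i_b Om] and [- i_c Om]. *)
Lemma jacobi_hor b c x : is_horizontal b -> is_horizontal c ->
  Om x [:: b x; c x] = - eta x (br b c x).
Proof.
move=> hb hc; have := schouten_fundamental 1 0 0 x is_horizontal0 hb hc.
have := wedge_reeb 1 0 0 x is_horizontal0 hb hc; rewrite schouten_eq => /= ->.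
have z0 b' : smooth_section b' -> (fun y => Om y [:: 0; b' y]) = fun=> 0.
  by move=> _; apply/funext => y; rewrite (Om0l Hcos).
rewrite !z0; [|exact: hb.1|exact: hc.1].
rewrite !act_cst bracket0l ?bracket0r; [|exact: hc.1|exact: hb.1].
rewrite (OmC Hcos (b x) 0) (OmC Hcos (c x) 0) !(Om0l Hcos).
rewrite /act anchor0; last by apply: (smooth_Om Hcos); [exact: hb.1|exact: hc.1].
lra.
Qed.

(** Evaluate on [- i_a Om] and [eta]. *)
Lemma jacobi_reeb a x : is_horizontal a -> eta x (br a xi x) = 0.
Proof.
move=> ha; have := schouten_reeb 0 1 x ha is_horizontal0.
rewrite reeb_eq bracket0l// (OmC Hcos (a x) 0) !(Om0l Hcos).
rewrite (_ : (fun y => Om y [:: a y; 0]) = fun=> 0).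
  rewrite act_cst linear0; lra.
by apply/funext => y; rewrite (OmC Hcos) (Om0l Hcos) oppr0.
Qed.

(** Decompose [a] and [b] into horizontal parts and multiples of [xi]. *)
Lemma jacobi_contact a b x : smooth_section a -> smooth_section b ->
  Om x [:: a x; b x] = d_eta a b x.
Proof.
move=> sa sb.
pose a' := horizontal_part eta xi a; pose b' := horizontal_part eta xi b.
have ha : is_horizontal a' by exact: horizontal_partP.
have hb : is_horizontal b' by exact: horizontal_partP.
have eta_cst u k : (forall y, eta y (u y) = k) -> (fun y => eta y (u y)) = fun=> k.
  by move=> H; apply/funext.
have split_hor (u v : section A) : smooth_section u -> smooth_section v ->
    d_eta u v x = d_eta (horizontal_part eta xi u) v x + eta x (u x) * d_eta xi v x.
  move=> su sv; have su' := (horizontal_partP su).1.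
  have seu : smooth_fun (fun y => eta y (u y)) by exact: smooth_cosection_eval.
  rewrite -(d_oneformZl L seta x seu sxi sv) -d_oneformDl//; last exact: smooth_sectionZ.
  apply: d_oneform_locall => //; first by apply: smooth_sectionD => //; exact: smooth_sectionZ.
  by rewrite /horizontal_part subrK.
have xi_hor u : is_horizontal u -> d_eta xi u x = 0.
  move=> hu; have [su eu] := hu; rewrite /d_oneform (eta_cst u 0)// (eta_cst xi 1)//.
  by rewrite !act_cst bracket_skew// linearN/= jacobi_reeb//; ring.
have xixi : d_eta xi xi x = 0 by have := d_oneformC L eta x sxi sxi; lra.
have xib : d_eta xi b x = 0.
  rewrite d_oneformC// split_hor// xixi mulr0 addr0.
  by rewrite -d_oneformC//; [exact: xi_hor|exact: hb.1].
rewrite split_hor// xib mulr0 addr0 d_oneformC//; last exact: ha.1.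
rewrite split_hor//; last exact: ha.1.
rewrite xi_hor// mulr0 addr0 -d_oneformC//; [|exact: ha.1|exact: hb.1].
rewrite {1}/d_oneform (eta_cst a' 0 ha.2) (eta_cst b' 0 hb.2) !act_cst !subr0 sub0r.
rewrite -jacobi_hor// /a' /b' /horizontal_part.
rewrite [a x - _]addrC [b x - _]addrC -!scaleNr (Om_linearl Hcos) (Om_xil Hxi).
by rewrite (Om_linearr Hcos) (Om_xir Hcos Hxi); ring.
Qed.

End JacobiToContact.
End ContactJacobi.

Theorem theorem3p7 (R : realType) (n m : nat) (M : manifold R n)
    (A : vbundle M (2 * m + 1)) (L : lie_algebroid A)
    (B : multivector A -> multivector A -> multivector A)
    (HB : is_schouten L B)
    (Omega : diff_form A) (eta : cosection A)
    (Pi : multivector A) (xi : section A)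
    (Hcos : almost_cosymplectic m Omega eta)
    (Hpair : fundamental_pair Omega eta Pi xi) :
  contact_structure L m Omega eta <-> jacobi_structure L B Pi xi.

Proof.
have [-> Hxi] := Hpair.
have kOm : kform 2 Omega by case: Hcos.
have seta : smooth_cosection eta by case: Hcos.
have sxi : smooth_section xi by case: Hxi.
have kPi := kvector_fundamental_bivector Hcos Hxi.
have contactP := exterior_differentialE L seta kOm.
have lieP := is_lie_multivectorE HB (fun _ _ => 0) sxi kPi.1.
split=> [[_ /contactP contact]|[_ _ schouten_eq /lieP reeb_eq]].
  split=> //; first exact: (contact_schouten HB Hcos Hxi contact).
  by apply/lieP; exact: (contact_schouten_reeb HB Hcos Hxi contact).
split=> //; apply/contactP => a b x.
exact: (jacobi_contact HB Hcos Hxi schouten_eq reeb_eq).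
Qed.
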